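(* Let $U\in C^2(\mathbb T)$ be a real-valued shear profile with zero mean, let $\nu>0$ and $K>0$, and set $\beta=K\varepsilon$ for $\varepsilon>0$. Assume $\varepsilon<\beta/\nu$ (that is, $K>\nu$). If $$\left\|\left(\partial_{yy}-\frac{\mathrm i K}{\nu}\right)^{-1}U'\right\|_{L^2}>\nu,$$ then for all sufficiently small $\varepsilon>0$ the operator $\mathcal L_{\nu,\varepsilon,\beta}$ with $\beta=K\varepsilon$ possesses an unstable eigenvalue, i.e. an eigenvalue with positive real part.
   Context: $\mathbb T=\mathbb R/2\pi\mathbb Z$, and $L^2=L^2(\mathbb T)$ (complex-valued functions) carries the normalized inner product $\langle f,g\rangle=\frac1{2\pi}\int_{\mathbb T}\overline{f}\,g\,dy$ and the associated norm. For $\nu,\varepsilon,\beta>0$, the operator $\mathcal L_{\nu,\varepsilon,\beta}:H^2(\mathbb T)\subset L^2(\mathbb T)\to L^2(\mathbb T)$ is $$\mathcal L_{\nu,\varepsilon,\beta}:=\nu(\partial_{yy}-\varepsilon^2)-\mathrm i\,\varepsilon\Big(U(y)-(U''(y)-\beta)(\partial_{yy}-\varepsilon^2)^{-1}\Big),$$ where $U(y)$ and $U''(y)-\beta$ act by multiplication. *)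

(* Defs.v *)
From HB Require Import structures.
From mathcomp Require Import all_boot all_order all_algebra.
From mathcomp Require Import all_classical all_reals all_analysis.
From mathcomp Require Import complex.

Set Implicit Arguments.
Unset Strict Implicit.
Unset Printing Implicit Defensive.

Import Order.TTheory GRing.Theory Num.Theory.
Import numFieldNormedType.Exports.

Local Open Scope ring_scope.
Local Open Scope complex_scope.
Local Open Scope classical_set_scope.

(* Functions on the torus T = R / 2 pi Z are 2 pi-periodic functions on R;
   elements of L^2(T) are such functions, identified when they agree almost
   everywhere. *)

Definition classCT (R : realType) (n : nat) (f : R -> R) : Prop :=
  [/\ periodic f (2 * pi),
      forall k, (k < n)%N -> forall y, derivable f^`(k) y 1 &
      continuous f^`(n)].

Definition rintT (R : realType) (f : R -> R) : R :=
  Rintegral lebesgue_measure `[0, 2 * pi] f.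

Definition cintT (R : realType) (f : R -> R[i]) : R[i] :=
  rintT (fun y => complex.Re (f y)) +i* rintT (fun y => complex.Im (f y)).

Definition innerT (R : realType) (f g : R -> R[i]) : R[i] :=
  ((2 * pi)^-1)%:C * cintT (fun y => ((f y)^*)%C * g y).

Definition normT (R : realType) (f : R -> R[i]) : R :=
  Num.sqrt (complex.Re (innerT f f)).

Definition L2T (R : realType) (f : R -> R[i]) : Prop :=
  [/\ periodic f (2 * pi),
      measurable_fun [set: R] (fun y => complex.Re (f y)),
      measurable_fun [set: R] (fun y => complex.Im (f y)) &
      (@lebesgue_measure R).-integrable `[0, 2 * pi]
        (fun y => (Normc.normc (f y) ^+ 2)%:E)].

(* g is the weak derivative of f.  Periodic test functions need no compact
   support; testing against C^1 or against C^oo functions is equivalent, and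
   real-valued ones suffice by linearity. *)
Definition is_wderivT (R : realType) (f g : R -> R[i]) : Prop :=
  [/\ L2T f, L2T g &
      forall phi : R -> R, classCT 1 phi ->
        cintT (fun y => f y * (phi^`()%classic y)%:C) =
        - cintT (fun y => g y * (phi y)%:C)].

Definition is_dyy (R : realType) (f h : R -> R[i]) : Prop :=
  exists2 g, is_wderivT f g & is_wderivT g h.

Definition H2T (R : realType) (f : R -> R[i]) : Prop :=
  exists h, is_dyy f h.

(* A representative of the second weak derivative; 0 outside H^2(T). *)
Definition dyy (R : realType) (f : R -> R[i]) : R -> R[i] :=
  xget (fun=> 0) [set h | is_dyy f h].

(* A representative of (d_yy - z)^{-1} f, that is, of the solution w in H^2(T)
   of w'' - z w = f; the default value 0 is returned if there is none. *)
Definition resolventT (R : realType) (z : R[i]) (f : R -> R[i]) : R -> R[i] :=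
  xget (fun=> 0)
    [set w | H2T w /\
       (fun y => dyy w y - z * w y) = f %[ae (@lebesgue_measure R)]].

Definition Lop (R : realType) (U : R -> R) (nu eps beta : R)
    (f : R -> R[i]) : R -> R[i] :=
  fun y =>
    nu%:C * (dyy f y - (eps ^+ 2)%:C * f y)
    - 'i%C * eps%:C *
      ((U y)%:C * f y
       - (U^`(2)%classic y - beta)%:C * resolventT (eps ^+ 2)%:C f y).

(* Eigenvalue of an operator on L^2(T) with domain H^2(T). *)
Definition is_eigenvalue (R : realType) (L : (R -> R[i]) -> R -> R[i])
    (lambda : R[i]) : Prop :=
  exists f : R -> R[i],
    [/\ H2T f,
        ~ (f = (fun=> 0) %[ae (@lebesgue_measure R)]) &
        L f = (fun y => lambda * f y) %[ae (@lebesgue_measure R)]].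

(* Main.v *)
(* For small eps there is an eigenvalue near i K, whose eigenfunction is close to
   the constant stream function and bifurcates from it: writing psi = 1 + eps phi
   with phi of mean zero, the eigenvalue equation splits into its mean, which gives
   lambda = i K - nu eps^2 - i eps^2 <U phi>, and an equation for phi'' of the
   form (nu d_yy - i K) phi'' = - i U'' + O(eps), solved by contraction in the
   space of continuous periodic functions.  At eps = 0 one has
   phi0' = - (i / nu) chi with chi = (d_yy - i K / nu)^{-1} U', and
   nu phi0'' - i K phi0 = - i U gives Im <U phi0> = |chi|^2 / nu.  Therefore
   Re lambda = eps^2 (|chi|^2 / nu - nu) + O(eps^3), which is positive.
   The eigenfunction is classical; the weak operators of the statement are
   matched with classical ones by uniqueness of weak solutions, proved by
   testing against classical solutions of the dual equation. *)

Require Import Defs.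
From mathcomp Require Import all_boot all_order all_algebra.
From mathcomp Require Import all_classical all_reals all_analysis.
From mathcomp Require Import measurable_realfun complex ring lra.

Import Order.TTheory GRing.Theory Num.Theory.
Import numFieldNormedType.Exports.

Local Open Scope ring_scope.
Local Open Scope complex_scope.
Local Open Scope classical_set_scope.

Set Implicit Arguments.
Unset Strict Implicit.
Unset Printing Implicit Defensive.

(** * Componentwise calculus for complex-valued functions *)

(** The obstacle is that the inverse of d_yy - eps^2 multiplies constants by -eps^-2, so the
    operators have no regular limit on vorticities as eps tends to 0. The stream function removes
    the singularity: psi = 1 has vorticity -eps^2, and the scaling beta = K eps puts the beta term
    at the same order, which leaves the finite value i K. Moreover the beta term cancels exactly
    against i K times the vorticity, both in the constant mode and in phi, so that only i K phi''
    remains. Taking g = phi'' as the unknown gives a second-order equation whose coefficients U and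
    U'' are merely bounded: phi is a double primitive of g, and U'' is never differentiated.
    Eliminating lambda makes the equation nonlinear, through the product of <U phi> with the
    vorticity; this is why a fixed point is needed. As i K / nu is the square of some m with nonzero
    real part, its resolvent factors into two first-order periodic problems, which have explicit
    solutions and uniform bounds; no Fourier series enter. *)

Section ComplexCalculus.
Variable R : realType.
Implicit Types (f g : R -> R[i]) (u : R -> R) (z w : R[i]).

(** Differentiation is by components, so that the real mean value and fundamental theorems apply
    directly; the derivative is carried as an explicit function. *)
Definition cder f f' := forall y : R,
  is_derive y 1 (fun x => complex.Re (f x)) (complex.Re (f' y)) /\
  is_derive y 1 (fun x => complex.Im (f x)) (complex.Im (f' y)).

Definition ccont f :=
  continuous (fun x => complex.Re (f x)) /\
  continuous (fun x => complex.Im (f x)).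

Lemma ReD z w : complex.Re (z + w) = complex.Re z + complex.Re w.
Proof. by case: z; case: w. Qed.
Lemma ImD z w : complex.Im (z + w) = complex.Im z + complex.Im w.
Proof. by case: z; case: w. Qed.
Lemma ReN z : complex.Re (- z) = - complex.Re z.
Proof. by case: z. Qed.
Lemma ImN z : complex.Im (- z) = - complex.Im z.
Proof. by case: z. Qed.
Lemma ReM z w : complex.Re (z * w) =
  complex.Re z * complex.Re w - complex.Im z * complex.Im w.
Proof. by case: z; case: w. Qed.
Lemma ImM z w : complex.Im (z * w) =
  complex.Re z * complex.Im w + complex.Im z * complex.Re w.
Proof. by case: z; case: w. Qed.
Definition ReImE := (ReD, ImD, ReN, ImN, ReM, ImM).

Lemma eq_complexP z w : complex.Re z = complex.Re w ->
  complex.Im z = complex.Im w -> z = w.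
Proof. by case: z; case: w => a b c d /= -> ->. Qed.

Lemma eq_is_derive u (y a b : R) : a = b -> is_derive y 1 u a -> is_derive y 1 u b.
Proof. by move=> ->. Qed.

Lemma eq_cder f f' g' : (forall y, f' y = g' y) -> cder f f' -> cder f g'.
Proof. by move=> /funext ->. Qed.

Lemma cder_cst z : cder (fun=> z) (fun=> 0).
Proof. by move=> y; split; exact: is_derive_cst. Qed.

Lemma cder_real u u' : (forall y : R, is_derive y 1 u (u' y)) ->
  cder (fun y => (u y)%:C) (fun y => (u' y)%:C).
Proof. by move=> du y; split; [exact: du|exact: is_derive_cst]. Qed.

Lemma is_derive_mul u v (y a b : R) : is_derive y 1 u a -> is_derive y 1 v b ->
  is_derive y 1 (fun x => u x * v x) (a * v y + u y * b).
Proof.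
move=> du dv; apply: is_derive_eq (@is_deriveM _ _ u v y 1 a b du dv) _.
by rewrite /GRing.scale /=; ring.
Qed.

Lemma is_derive_add u v (y a b : R) : is_derive y 1 u a -> is_derive y 1 v b ->
  is_derive y 1 (fun x => u x + v x) (a + b).
Proof. exact: is_deriveD. Qed.

Lemma is_derive_sub u v (y a b : R) : is_derive y 1 u a -> is_derive y 1 v b ->
  is_derive y 1 (fun x => u x - v x) (a - b).
Proof. exact: is_deriveB. Qed.

Lemma cderD f f' g g' : cder f f' -> cder g g' ->
  cder (fun y => f y + g y) (fun y => f' y + g' y).
Proof.
move=> df dg y; have [a b] := df y; have [c d] := dg y.
rewrite !ReImE; split.
- rewrite (_ : (fun x => _) = fun x => complex.Re (f x) + complex.Re (g x));
    last by apply/funext => x; rewrite ReImE.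
  exact: is_derive_add.
- rewrite (_ : (fun x => _) = fun x => complex.Im (f x) + complex.Im (g x));
    last by apply/funext => x; rewrite ReImE.
  exact: is_derive_add.
Qed.

Lemma cderM f f' g g' : cder f f' -> cder g g' ->
  cder (fun y => f y * g y) (fun y => f' y * g y + f y * g' y).
Proof.
move=> df dg y; have [a b] := df y; have [c d] := dg y.
rewrite !ReImE; split.
- rewrite (_ : (fun x => _) = (fun x =>
     complex.Re (f x) * complex.Re (g x) - complex.Im (f x) * complex.Im (g x)));
    last by apply/funext => x; rewrite ReImE.
  refine (eq_is_derive _ (is_derive_sub (is_derive_mul a c) (is_derive_mul b d))).
  by rewrite /=; ring.
- rewrite (_ : (fun x => _) = (fun x =>
     complex.Re (f x) * complex.Im (g x) + complex.Im (f x) * complex.Re (g x)));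
    last by apply/funext => x; rewrite ReImE.
  refine (eq_is_derive _ (is_derive_add (is_derive_mul a d) (is_derive_mul b c))).
  by rewrite /=; ring.
Qed.

Lemma cderZ z f f' : cder f f' -> cder (fun y => z * f y) (fun y => z * f' y).
Proof.
by move=> df; apply: eq_cder (cderM (cder_cst z) df) => y; rewrite mul0r add0r.
Qed.

Lemma cderB f f' g g' : cder f f' -> cder g g' ->
  cder (fun y => f y - g y) (fun y => f' y - g' y).
Proof.
move=> df /(cderZ (-1)) dg; have := cderD df dg.
have -> : (fun y => f y + -1 * g y) = (fun y => f y - g y).
  by apply/funext => y; rewrite mulN1r.
by apply: eq_cder => y; rewrite mulN1r.
Qed.

Lemma is_derive_continuous u u' :
  (forall y : R, is_derive y 1 u (u' y)) -> continuous u.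
Proof.
by move=> du y; have [h _] := du y; exact/differentiable_continuous/derivable1_diffP.
Qed.

Lemma cder_ccont f f' : cder f f' -> ccont f.
Proof.
by move=> df; split; apply: is_derive_continuous => y; [apply (df y).1|apply (df y).2].
Qed.

Lemma cder0_cst f : cder f (fun=> 0) -> forall x y, f x = f y.
Proof.
move=> df x y; apply: eq_complexP.
- by apply: (@is_derive_0_is_cst _ (fun x => complex.Re (f x))) => t; apply (df t).1.
- by apply: (@is_derive_0_is_cst _ (fun x => complex.Im (f x))) => t; apply (df t).2.
Qed.

Lemma is_derive_shift u (a y b : R) :
  is_derive (y + a) 1 u b -> is_derive y 1 (fun x => u (x + a)) b.
Proof.
move=> du; have := @is_derive1_comp R u (fun x : R => x + a) y b 1.
rewrite mulr1; apply => //.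
refine (eq_is_derive _ (is_derive_add (is_derive_id y 1) (is_derive_cst a y 1))).
by rewrite addr0.
Qed.

Lemma cder_shift f f' a : cder f f' -> cder (fun y => f (y + a)) (fun y => f' (y + a)).
Proof.
move=> df y; have [h1 h2] := df (y + a); split.
- exact: (@is_derive_shift (fun x => complex.Re (f x))).
- exact: (@is_derive_shift (fun x => complex.Im (f x))).
Qed.

Lemma is_derive_uniq u (y a b : R) : is_derive y 1 u a -> is_derive y 1 u b -> a = b.
Proof. by move=> [_ <-] [_ <-]. Qed.

Lemma cder_uniq f f' g' : cder f f' -> cder f g' -> forall y, f' y = g' y.
Proof.
move=> df dg y; have [a b] := df y; have [c d] := dg y.
by apply: eq_complexP; [exact: is_derive_uniq a c|exact: is_derive_uniq b d].
Qed.

Lemma cder_periodic f f' a : cder f f' -> periodic f a -> periodic f' a.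
Proof.
move=> df pf y; have d := cder_shift a df.
have E : (fun y => f (y + a)) = f by apply/funext.
by rewrite E in d; exact: esym (cder_uniq df d y).
Qed.

Lemma ccont_cst z : ccont (fun=> z).
Proof. by split=> ?; exact: cvg_cst. Qed.

Lemma ccont_real u : continuous u -> ccont (fun y => (u y)%:C).
Proof. by move=> cu; split => //= x; exact: cvg_cst. Qed.

Lemma continuous_add u v : continuous u -> continuous v -> continuous (fun x => u x + v x).
Proof. by move=> cu cv x; exact: cvgD (cu x) (cv x). Qed.

Lemma continuous_sub u v : continuous u -> continuous v -> continuous (fun x => u x - v x).
Proof. by move=> cu cv x; exact: cvgB (cu x) (cv x). Qed.

Lemma continuous_mul u v : continuous u -> continuous v -> continuous (fun x => u x * v x).
Proof. by move=> cu cv x; exact: cvgM (cu x) (cv x). Qed.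

Lemma ccontD f g : ccont f -> ccont g -> ccont (fun y => f y + g y).
Proof.
move=> [a b] [c d]; split.
- rewrite (_ : (fun x => _) = (fun x => complex.Re (f x) + complex.Re (g x)));
    last by apply/funext => x; rewrite ReImE.
  exact: continuous_add.
- rewrite (_ : (fun x => _) = (fun x => complex.Im (f x) + complex.Im (g x)));
    last by apply/funext => x; rewrite ReImE.
  exact: continuous_add.
Qed.

Lemma ccontM f g : ccont f -> ccont g -> ccont (fun y => f y * g y).
Proof.
move=> [a b] [c d]; split.
- rewrite (_ : (fun x => _) = (fun x => complex.Re (f x) * complex.Re (g x)
      - complex.Im (f x) * complex.Im (g x)));
    last by apply/funext => x; rewrite ReImE.
  exact: continuous_sub (continuous_mul a c) (continuous_mul b d).
- rewrite (_ : (fun x => _) = (fun x => complex.Re (f x) * complex.Im (g x)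
      + complex.Im (f x) * complex.Re (g x)));
    last by apply/funext => x; rewrite ReImE.
  exact: continuous_add (continuous_mul a d) (continuous_mul b c).
Qed.

Lemma ccontZ z f : ccont f -> ccont (fun y => z * f y).
Proof. by move=> cf; apply: ccontM => //; exact: ccont_cst. Qed.

Lemma ccontB f g : ccont f -> ccont g -> ccont (fun y => f y - g y).
Proof.
move=> cf /(ccontZ (-1)) cg; have := ccontD cf cg.
rewrite (_ : (fun y => f y + -1 * g y) = (fun y => f y - g y)) //.
by apply/funext => y; rewrite mulN1r.
Qed.

Lemma ccont_integrable u (a b : R) : continuous u ->
  (@lebesgue_measure R).-integrable `[a, b] (EFin \o u).
Proof.
move=> cu; apply: continuous_compact_integrable; first exact: segment_compact.
exact: continuous_subspaceT.
Qed.

(** An integral from a fixed base point a is differentiable only to the right of a. Normalized to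
    vanish at 0, it does not depend on a, so the base point may move with x and stay to its left. *)
Lemma exists_primitive u : continuous u ->
  exists v : R -> R, forall y : R, is_derive y 1 v (u y).
Proof.
move=> cu.
pose F (a x : R) : R := Rintegral lebesgue_measure `[a, x] u - Rintegral lebesgue_measure `[a, 0] u.
have FE a b x : a <= b -> b <= 0 -> b <= x -> F a x = F b x.
  move=> ab b0 bx.
  have E c : b <= c -> Rintegral lebesgue_measure `[a, c] u =
      Rintegral lebesgue_measure `[a, b] u + Rintegral lebesgue_measure `[b, c] u.
    move=> bc.
    have := @Rintegral_itvB R u (BLeft a) (BRight c) b (ccont_integrable a c cu).
    rewrite !bnd_simp => /(_ ab bc) E1.
    rewrite -(@Rintegral_itv_obnd_cbnd R b (BRight c)).
      by rewrite -E1; ring.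
    have := ccont_integrable b c cu; apply: integrableS => //.
    by apply: subset_itvr; rewrite bnd_simp.
  by rewrite /F (E x bx) (E 0 b0); ring.
have dF (a x : R) : a < x -> is_derive x 1 (F a) (u x).
  move=> ax.
  have [d e] := @continuous_FTC1_closed R u a x (x + 1) (ltac:(by rewrite ltrDl)) (ccont_integrable a (x + 1) cu) ax (cu x).
  have dI : is_derive x 1 (fun x => Rintegral lebesgue_measure `[a, x] u) (u x).
    by apply: DeriveDef; [exact: d|rewrite -derive1E; exact: e].
  refine (eq_is_derive _ (is_derive_sub dI
    (is_derive_cst (Rintegral lebesgue_measure `[a, 0] u) x 1))).
  by rewrite subr0.
exists (fun x => F (- `|x| - 1) x) => y.
(* The fixed base -(|y| + 2) lies below -|x| - 1 for all x within distance 1 of y. *)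
have ly : - (`|y| + 2) < y by have := ler_norm (- y); rewrite normrN; lra.
apply: near_eq_is_derive (dF _ _ ly) => //.
near=> x.
apply: FE; [|have := normr_ge0 x; lra|have := ler_norm (-x); rewrite normrN; lra].
have : `|y - x| < 1 by near: x; apply: (@nbhsx_ballx R R^o y 1).
have := lerB_dist x y; rewrite distrC; lra.
Unshelve. all: by end_near.
Qed.

End ComplexCalculus.

(** * Periodic solutions of linear equations *)

Section PeriodicODE.
Variable R : realType.
Implicit Types (f g h v w : R -> R[i]) (u : R -> R) (z m : R[i]).

(* A square-root-free substitute for |z| <= d. *)
Definition bd (d : R) z := `|complex.Re z| <= d /\ `|complex.Im z| <= d.

Lemma bdW d e z : d <= e -> bd d z -> bd e z.
Proof. by move=> de [a b]; split; exact: le_trans de. Qed.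

Lemma bdD d e z m : bd d z -> bd e m -> bd (d + e) (z + m).
Proof.
move=> [a b] [a' b']; rewrite /bd !ReImE.
by split; apply: le_trans (ler_normD _ _) _; exact: lerD.
Qed.

Lemma bdN d z : bd d z -> bd d (- z).
Proof. by move=> [a b]; rewrite /bd !ReImE !normrN. Qed.

Lemma bdB d e z m : bd d z -> bd e m -> bd (d + e) (z - m).
Proof. by move=> a /bdN; exact: bdD. Qed.

Lemma bdM d e z m : bd d z -> bd e m -> bd (2 * (d * e)) (z * m).
Proof.
move=> [a b] [a' b']; rewrite /bd !ReImE.
have M (x y p q : R) : `|x| <= p -> `|y| <= q -> `|x * y| <= p * q.
  by move=> ? ?; rewrite normrM; apply: ler_pM.
split.
- by apply: le_trans (ler_normB _ _) _; have := M _ _ _ _ a a'; have := M _ _ _ _ b b'; lra.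
- by apply: le_trans (ler_normD _ _) _; have := M _ _ _ _ a b'; have := M _ _ _ _ b a'; lra.
Qed.

Lemma bdZ (x : R) d z : bd d z -> bd (`|x| * d) (x%:C * z).
Proof.
move=> [a b]; rewrite /bd !ReImE /= !mul0r subr0 addr0 !normrM.
by split; apply: ler_wpM2l.
Qed.

Lemma bdi d z : bd d z -> bd d ('i%C * z).
Proof.
by move=> [a b]; rewrite /bd !ReImE /= !mul0r !mul1r sub0r add0r normrN.
Qed.

Lemma bd_ge0 d z : bd d z -> 0 <= d.
Proof. by move=> [a _]; exact: le_trans a. Qed.

Lemma bd0P z : (forall e, 0 < e -> bd e z) -> z = 0.
Proof.
move=> h; apply: eq_complexP => /=; apply/eqP; rewrite -normr_le0.
- by apply/ler_addgt0Pr => e e0; rewrite add0r; apply (h e e0).1.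
- by apply/ler_addgt0Pr => e e0; rewrite add0r; apply (h e e0).2.
Qed.

Lemma pi2_gt0 : 0 < 2 * pi :> R.
Proof. by rewrite mulr_gt0 ?pi_gt0. Qed.

Lemma periodic_int (T : zmodType) (F : R -> T) (a : R) : periodic F a ->
  forall (k : int) y, F (y + a *~ k) = F y.
Proof.
move=> pF [n|n] y; first exact: periodicn.
by rewrite -[y in RHS](subrK (a *+ n.+1)) (periodicn pF).
Qed.

Lemma periodic_reduce (y : R) : exists y0 : R, 0 <= y0 <= 2 * pi /\
  forall (T : zmodType) (F : R -> T), periodic F (2 * pi) -> F y = F y0.
Proof.
have p0 := pi2_gt0.
exists (y + (2 * pi) *~ - Num.floor (y / (2 * pi))); split.
  have /andP[] := floor_itv (y / (2 * pi)).
  rewrite ler_pdivlMr // ltr_pdivrMr // intrD mulrNz -mulrzl.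
  by move=> a b; apply/andP; split; lra.
by move=> T F pF; rewrite periodic_int.
Qed.

Lemma periodic_max u : continuous u -> periodic u (2 * pi) ->
  exists c, forall t, u t <= u c.
Proof.
move=> cu pu.
have [c _ hc] := @EVT_max R u 0 (2 * pi) (ltW pi2_gt0) (continuous_subspaceT cu).
exists c => t; have [t0 [ht ->//]] := periodic_reduce t.
by apply: hc; rewrite in_itv.
Qed.

Lemma periodic_bounded f : ccont f -> periodic f (2 * pi) ->
  exists2 d, 0 <= d & forall y, bd d (f y).
Proof.
move=> [c1 c2] pf.
have H u : continuous u -> periodic u (2 * pi) -> exists2 d, 0 <= d & forall y, `|u y| <= d.
  move=> cu pu.
  have [c hc] := @periodic_max (fun y => `|u y|) (fun y => continuous_comp (cu y) (@norm_continuous _ _ _)) (fun y => congr1 _ (pu y)).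
  by exists `|u c|.
have [d1 d10 h1] := H _ c1 (fun y => congr1 _ (pf y)).
have [d2 d20 h2] := H _ c2 (fun y => congr1 _ (pf y)).
exists (d1 + d2); first exact: addr_ge0.
move=> y; split.
- by apply: le_trans (h1 y) _; rewrite lerDl.
- by apply: le_trans (h2 y) _; rewrite lerDr.
Qed.

Lemma is_derive_max u u' : (forall y : R, is_derive y 1 u (u' y)) ->
  forall c, (forall t, u t <= u c) -> u' c = 0.
Proof.
move=> du c hc.
have ab : c - 1 <= c + 1 by lra.
have h := @derive1_at_max R u (c - 1) (c + 1) c ab
  (fun t _ => (let: DeriveDef d _ := du t in d)).
apply: is_derive_uniq (du c) (h _ (fun t _ => hc t)).
by rewrite in_itv /=; lra.
Qed.

(** The complex exponential e^(m y). *)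
Definition cE m : R -> R[i] := fun y =>
  (expR (complex.Re m * y))%:C *
  (cos (complex.Im m * y) +i* sin (complex.Im m * y)).

Lemma cE_der m : cder (cE m) (fun y => m * cE m y).
Proof.
move=> y; rewrite /cE; case: m => a b /=.
have L c : is_derive y 1 (fun x : R => c * x) c.
  refine (eq_is_derive _ (is_derive_mul (is_derive_cst c y 1) (is_derive_id y 1))).
  by rewrite mul0r add0r mulr1.
have dE := @is_derive1_comp R expR (fun x : R => a * x) y _ _ (is_derive_expR _) (L a).
have dc := @is_derive1_comp R cos (fun x : R => b * x) y _ _ (is_derive_cos _) (L b).
have ds := @is_derive1_comp R sin (fun x : R => b * x) y _ _ (is_derive_sin _) (L b).
split.
- rewrite (_ : (fun x => _) = (fun x => expR (a * x) * cos (b * x)));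
    last by apply/funext => x; rewrite mul0r subr0.
  by refine (eq_is_derive _ (is_derive_mul dE dc)); rewrite /=; ring.
- rewrite (_ : (fun x => _) = (fun x => expR (a * x) * sin (b * x)));
    last by apply/funext => x; rewrite mul0r addr0.
  by refine (eq_is_derive _ (is_derive_mul dE ds)); rewrite /=; ring.
Qed.

Lemma cE0 m : cE m 0 = 1.
Proof. by rewrite /cE !mulr0 expR0 cos0 sin0 mul1r. Qed.

Lemma cENM m y : cE (- m) y * cE m y = 1.
Proof.
rewrite -(cE0 m) -[cE m 0]mul1r -(cE0 (- m)).
apply: (cder0_cst (f := fun y => cE (- m) y * cE m y)).
apply: eq_cder (cderM (cE_der _) (cE_der _)) => x; ring.
Qed.

(** The squared modulus of e^(m y) is e^(2 Re m y), which is 1 only if the exponent vanishes. At y =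
    2 pi this is the nonresonance that makes the periodic problem solvable. *)
Lemma cE_neq1 m (y : R) : y != 0 -> complex.Re m != 0 -> cE m y != 1.
Proof.
move=> y0 m0; apply/eqP => /eqP; rewrite /cE eq_complex /= mul0r subr0 mul0r addr0.
move=> /andP[/eqP e1 /eqP e2].
have : expR (complex.Re m * y) ^+ 2 = 1.
  have := cos2Dsin2 (complex.Im m * y).
  by move=> /(congr1 (fun t => expR (complex.Re m * y) ^+ 2 * t));
    rewrite mulr1 mulrDr -!exprMn e1 e2 => <-; ring.
move/eqP; rewrite -expRM_natl -[X in _ == X]expR0 => /eqP/expR_inj/eqP.
by rewrite mulf_eq0 pnatr_eq0 /= mulf_eq0 (negbTE y0) (negbTE m0).
Qed.

Lemma exists_cprimitive h : ccont h -> exists v, cder v h.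
Proof.
move=> [/exists_primitive[a da] /exists_primitive[b db]].
by exists (fun y => a y +i* b y) => y; split; [exact: da|exact: db].
Qed.

Lemma linear_ode_unique m v : cder v (fun y => m * v y) -> v 0 = 0 ->
  forall y, v y = 0.
Proof.
move=> dv v0 y.
have E : cE (- m) y * v y = 0.
  rewrite -[RHS](mulr0 (cE (- m) 0)) -[in RHS]v0.
  apply: (cder0_cst (f := fun y => cE (- m) y * v y)).
  by apply: eq_cder (cderM (cE_der _) dv) => x; ring.
by rewrite -[LHS]mul1r -(cENM m y) mulrAC E mul0r.
Qed.

Lemma periodic_ode1 m h : complex.Re m != 0 -> ccont h -> periodic h (2 * pi) ->
  exists2 v, periodic v (2 * pi) & cder v (fun y => m * v y + h y).
Proof.
move=> m0 ch ph.
have [P dP] : exists P, cder P (fun y => cE (- m) y * h y).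
  by apply: exists_cprimitive; apply: ccontM => //; exact: cder_ccont (cE_der _).
have E1 : 1 - cE m (2 * pi) != 0.
  by rewrite subr_eq0 eq_sym cE_neq1 // gt_eqF ?pi2_gt0.
(* Variation of constants, with [c] determined by v(2 pi) = v(0). *)
pose c := (cE m (2 * pi) * P (2 * pi) - P 0) / (1 - cE m (2 * pi)).
pose v y := cE m y * (c + P y).
have dv : cder v (fun y => m * v y + h y).
  apply: eq_cder (cderM (cE_der m) (cderD (cder_cst c) dP)) => y.
  rewrite /v add0r mulrA [cE m y * _]mulrC cENM; ring.
(* The difference v(y + 2 pi) - v(y) solves the homogeneous equation and vanishes at 0. *)
exists v => // y; apply/eqP; rewrite -subr_eq0; apply/eqP.
apply: (@linear_ode_unique m (fun y => v (y + 2 * pi) - v y)) => [|{y}].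
  by apply: eq_cder (cderB (cder_shift (2 * pi) dv) dv) => x; rewrite ph; ring.
rewrite /v add0r cE0 mul1r /c.
by field.
Qed.

(* |v|^2 has zero derivative at its maximum, so there |Re m| |v|^2 <= |v| |h|. *)
Lemma periodic_ode1_bound m h v d : complex.Re m != 0 -> periodic v (2 * pi) ->
  cder v (fun y => m * v y + h y) -> (forall y, bd d (h y)) ->
  forall y, bd (2 * d / `|complex.Re m|) (v y).
Proof.
move=> m0 pv dv hb.
have d0 := bd_ge0 (hb 0).
pose q y := complex.Re (v y) * complex.Re (v y) + complex.Im (v y) * complex.Im (v y).
pose q' y := 2 * (complex.Re m * q y + complex.Re (v y) * complex.Re (h y)
                                     + complex.Im (v y) * complex.Im (h y)).
have dq (y : R) : is_derive y 1 q (q' y).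
  have [a b] := dv y.
  refine (eq_is_derive _ (is_derive_add (is_derive_mul a a) (is_derive_mul b b))).
  by rewrite /q' /q !ReImE; ring.
have [c hc] : exists c, forall t, q t <= q c.
  apply: periodic_max; first exact: is_derive_continuous dq.
  by move=> y; rewrite /q pv.
have := is_derive_max dq hc; rewrite /q' => /eqP; rewrite mulf_eq0 pnatr_eq0 /= => /eqP e.
have [h1 h2] := hb c.
set k := `|complex.Re m|.
have k0 : 0 < k by rewrite normr_gt0.
have q0 : 0 <= q c by rewrite /q -!expr2 addr_ge0 ?sqr_ge0.
set A := complex.Re (v c) in e *; set B := complex.Im (v c) in e *.
set H1 := complex.Re (h c) in e h1; set H2 := complex.Im (h c) in e h2.
have e1 : k * q c <= d * (`|A| + `|B|).
  rewrite /k -(ger0_norm q0) -normrM.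
  have -> : complex.Re m * q c = - (A * H1 + B * H2) by lra.
  rewrite normrN; apply: le_trans (ler_normD _ _) _; rewrite !normrM.
  have := ler_wpM2l (normr_ge0 A) h1; have := ler_wpM2l (normr_ge0 B) h2; lra.
(* This stands in for Cauchy-Schwarz on components; the resulting factor sqrt 2 is rounded up to
   2. *)
have e2 : (`|A| + `|B|) ^+ 2 <= 2 * q c.
  have : q c = `|A| ^+ 2 + `|B| ^+ 2 by rewrite !real_normK ?num_real.
  by move=> ->; have := sqr_ge0 (`|A| - `|B|); nra.
have e3 : k ^+ 2 * q c <= (2 * d) ^+ 2.
  have [->|qn0] := eqVneq (q c) 0; first by rewrite mulr0 sqr_ge0.
  have qp : 0 < q c by rewrite lt_def qn0.
  rewrite -(ler_pM2r qp).
  have -> : k ^+ 2 * q c * q c = (k * q c) ^+ 2 by ring.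
  apply: (@le_trans _ _ ((d * (`|A| + `|B|)) ^+ 2)).
    by rewrite ler_sqr // nnegrE mulr_ge0 // ?addr_ge0 // ltW.
  by have := ler_wpM2l (sqr_ge0 d) e2; have := mulr_ge0 (sqr_ge0 d) q0; rewrite !exprMn; lra.
have K x : x ^+ 2 <= q c -> `|x| <= 2 * d / k.
  move=> xq; rewrite ler_pdivlMr // -[leRHS]ger0_norm ?mulr_ge0 //.
  rewrite -[k]ger0_norm ?(ltW k0) // -normrM.
  rewrite -ler_sqr ?nnegrE // !real_normK ?num_real //.
  by apply: le_trans e3; rewrite exprMn mulrC; apply: ler_wpM2l; rewrite ?sqr_ge0.
move=> y; have := hc y; rewrite {1}/q => hq.
split; apply: K; apply: le_trans hq; rewrite -!expr2.
- by rewrite lerDl sqr_ge0.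
- by rewrite lerDr sqr_ge0.
Qed.

(** Classical counterpart of [resolventT]: w = (d_yy - z)^{-1} h. *)
Definition solves2 z h w := periodic w (2 * pi) /\
  exists2 w1, cder w w1 & cder w1 (fun y => z * w y + h y).

(* d_yy - m^2 = (d_y - m) (d_y + m). *)
Lemma periodic_ode2 m h : complex.Re m != 0 -> ccont h -> periodic h (2 * pi) ->
  exists w, solves2 (m * m) h w.
Proof.
move=> m0 ch ph.
have [v pv dv] := periodic_ode1 m0 ch ph.
have [|w pw dw] := @periodic_ode1 (- m) v _ (cder_ccont dv) pv.
  by rewrite ReN oppr_eq0.
exists w; split => //; exists (fun y => - m * w y + v y) => //.
by apply: eq_cder (cderD (cderZ (- m) dw) dv) => y; ring.
Qed.

(** With v = w' + m w one has v' = m v + h and w' = - m w + v, so the first-order bound, with its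
    factor 2 / |Re m|, is used twice. *)
Lemma periodic_ode2_bound m h w d : complex.Re m != 0 -> solves2 (m * m) h w ->
  (forall y, bd d (h y)) -> forall y, bd (4 / `|complex.Re m| ^+ 2 * d) (w y).
Proof.
move=> m0 [pw [w1 dw dw1]] hb.
pose v y := w1 y + m * w y.
have pv : periodic v (2 * pi).
  by move=> y; rewrite /v pw (cder_periodic dw pw).
have dv : cder v (fun y => m * v y + h y).
  by apply: eq_cder (cderD dw1 (cderZ m dw)) => y; rewrite /v; ring.
have vb := periodic_ode1_bound m0 pv dv hb.
have -> : 4 / `|complex.Re m| ^+ 2 * d =
    2 * (2 * d / `|complex.Re m|) / `|complex.Re (- m)|.
  by rewrite ReN normrN; field; rewrite normr_eq0.
apply: (@periodic_ode1_bound (- m) v) => //; first by rewrite ReN oppr_eq0.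
by apply: eq_cder dw => y; rewrite /v; ring.
Qed.

Lemma solves2_ccont z h w : solves2 z h w -> ccont w.
Proof. by move=> [_ [w1 dw _]]; exact: cder_ccont dw. Qed.

Lemma solves2B z h h' w w' : solves2 z h w -> solves2 z h' w' ->
  solves2 z (fun y => h y - h' y) (fun y => w y - w' y).
Proof.
move=> [pw [w1 dw dw1]] [pw' [w1' dw' dw1']]; split.
  by move=> y; rewrite pw pw'.
exists (fun y => w1 y - w1' y); first exact: cderB.
by apply: eq_cder (cderB dw1 dw1') => y; ring.
Qed.

End PeriodicODE.

(** * Contractions in the uniform norm *)

Section FixedPoint.
Variable R : realType.
Implicit Types (f g h v w : R -> R[i]) (u : R -> R) (z m : R[i]).

(** The intervals of radius 2 C / 2^n around a_n are nested, so the supremum of their left end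
    points lies in all of them. *)
Lemma geometric_limit (a : nat -> R) (C : R) :
  (forall n, `|a n.+1 - a n| <= C / 2 ^+ n) ->
  exists l, forall n, `|a n - l| <= 2 * C / 2 ^+ n.
Proof.
move=> ha.
have p2 n : 0 < 2 ^+ n :> R by rewrite exprn_gt0.
have lo (n k : nat) : (n <= k)%N -> `|a k - a n| <= 2 * C / 2 ^+ n - 2 * C / 2 ^+ k.
  elim: k => [|k IH]; first by rewrite leqn0 => /eqP ->; rewrite !subrr normr0.
  rewrite leq_eqVlt => /predU1P[->|/IH]; first by rewrite !subrr normr0.
  have E : 2 * C / 2 ^+ k.+1 = C / 2 ^+ k by rewrite exprS; field; rewrite gt_eqF.
  have := ha k; rewrite E => h1 h2.
  have -> : a k.+1 - a n = (a k.+1 - a k) + (a k - a n) by ring.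
  apply: le_trans (ler_normD _ _) _; move: h1 h2.
  have -> : 2 * C / 2 ^+ k = 2 * (C / 2 ^+ k) by ring.
  lra.
have C0 : 0 <= C by have := ha 0; rewrite expr0 divr1; apply: le_trans.
have pos n : 0 <= 2 * C / 2 ^+ n by rewrite divr_ge0 ?mulr_ge0 // ltW.
pose L := [set a n - 2 * C / 2 ^+ n | n in [set: nat]].
have ub n : ubound L (a n + 2 * C / 2 ^+ n).
  move=> _ [m _ <-].
  have [nm|/ltnW mn] := leqP n m.
  - by have := lo _ _ nm; have := pos m; have := ler_norm (a m - a n); lra.
  - by have := lo _ _ mn; have := pos n; have := ler_norm (a m - a n); rewrite distrC; lra.
have hL : has_sup L.
  by split; [exists (a 0 - 2 * C / 2 ^+ 0); exists 0|exists (a 0 + 2 * C / 2 ^+ 0)].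
exists (sup L) => n; rewrite ler_distlC; apply/andP; split.
- have : a n - 2 * C / 2 ^+ n <= sup L by apply: ub_le_sup; [case: hL|exists n].
  lra.
- have : L !=set0 by case: hL.
  by move=> /(@ge_sup R)/(_ (ub n)).
Qed.

(** Banach's theorem with factor 1/2. The map is a relation because images come from existence
    statements; the contraction hypothesis with d = 0 makes them unique. [D] bounds the first step
    of the iteration, and closedness of X under uniform limits keeps the limit in X. *)
Lemma uniform_fixpoint (X : (R -> R[i]) -> Prop)
    (T : (R -> R[i]) -> (R -> R[i]) -> Prop) (D : R) g0 :
  X g0 ->
  (forall g h, X g -> X h -> forall y, bd D (g y - h y)) ->
  (forall g, (forall e, 0 < e -> exists2 h, X h & forall y, bd e (h y - g y)) -> X g) ->
  (forall g, X g -> exists2 g', X g' & T g g') ->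
  (forall g h g' h' d, X g -> X h -> T g g' -> T h h' ->
    (forall y, bd d (g y - h y)) -> forall y, bd (d / 2) (g' y - h' y)) ->
  exists2 g, X g & T g g.
Proof.
move=> X0 diam cl ex ctr.
pose S g := xget g0 [set g' | X g' /\ T g g'].
have SP g : X g -> X (S g) /\ T g (S g).
  move=> /ex[g' Xg' Tg']; rewrite /S.
  by case: xgetP => [x _ //|/(_ g')]; case.
pose s n := iter n S g0.
have Xs n : X (s n) by elim: n => // n /SP[].
have p2 n : 0 < 2 ^+ n :> R by rewrite exprn_gt0.
have ds n y : bd (D / 2 ^+ n) (s n.+1 y - s n y).
  elim: n y => [|n IH] y; first by rewrite expr0 divr1; exact: diam.
  have -> : D / 2 ^+ n.+1 = D / 2 ^+ n / 2 by rewrite exprS; field; rewrite gt_eqF.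
  by apply: (ctr (s n.+1) (s n)) => //; apply SP.
have lim y : exists l, forall n, bd (2 * D / 2 ^+ n) (s n y - l).
  have [l1 h1] := @geometric_limit (fun n => complex.Re (s n y)) D
    (fun n => ltac:(have := (ds n y).1; rewrite !ReImE; exact)).
  have [l2 h2] := @geometric_limit (fun n => complex.Im (s n y)) D
    (fun n => ltac:(have := (ds n y).2; rewrite !ReImE; exact)).
  by exists (l1 +i* l2) => n; rewrite /bd !ReImE.
have [l hl] := choice lim.
have small e : 0 < e -> exists n, 2 * D / 2 ^+ n <= e.
  move=> e0.
  pose n := (Num.truncn (2 * D / e)).+1.
  exists n; rewrite ler_pdivrMr // [leRHS]mulrC -ler_pdivrMr //.
  apply: (@le_trans _ _ n%:R); first exact/ltW/truncnS_gt.
  by rewrite -natrX ler_nat ltnW // ltn_expl.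
have Xl : X l.
  apply: cl => e /small[n hn]; exists (s n) => // y.
  exact: bdW hn (hl y n).
have [XSl TSl] := SP _ Xl.
exists l => //; suff E : S l = l by rewrite E in TSl.
apply/funext => y; apply/eqP; rewrite -subr_eq0; apply/eqP/bd0P => e e0.
have [n hn] := small (e / 2) ltac:(by rewrite divr_gt0).
have h1 : bd (2 * D / 2 ^+ n / 2) (s n.+1 y - S l y).
  by apply: (ctr (s n) l) => //; apply SP.
have h2 := hl y n.+1.
have -> : S l y - l y = (s n.+1 y - l y) - (s n.+1 y - S l y) by ring.
apply: bdW (bdB h2 h1).
have -> : 2 * D / 2 ^+ n.+1 = 2 * D / 2 ^+ n / 2 by rewrite exprS; field; rewrite gt_eqF.
lra.
Qed.

Lemma uniform_limit_cont u :
  (forall e : R, 0 < e -> exists2 v : R -> R, continuous v & forall y, `|v y - u y| <= e) ->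
  continuous u.
Proof.
move=> h x; apply/cvgrPdist_lt => e e0.
have [v cv hv] := h (e / 4) ltac:(by rewrite divr_gt0).
have e4 : 0 < e / 4 by rewrite divr_gt0.
have := cv x; move=> /cvgrPdist_lt/(_ _ e4); apply: filterS => t /= ht.
have -> : u x - u t = - (v x - u x) + (v x - v t) + (v t - u t) by ring.
apply: le_lt_trans (ler_normD _ _) _.
apply: le_lt_trans (lerD (ler_normD _ _) (lexx _)) _.
by rewrite normrN; have := hv x; have := hv t; lra.
Qed.

Lemma uniform_limit_ccont g :
  (forall e, 0 < e -> exists2 h, ccont h & forall y, bd e (h y - g y)) -> ccont g.
Proof.
move=> hg; split; apply: uniform_limit_cont => e /hg[h [c1 c2] hh].
- by exists (fun x => complex.Re (h x)) => // y; have := (hh y).1; rewrite !ReImE.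
- by exists (fun x => complex.Im (h x)) => // y; have := (hh y).2; rewrite !ReImE.
Qed.

Lemma uniform_limit_periodic g (a : R) :
  (forall e, 0 < e -> exists2 h, periodic h a & forall y, bd e (h y - g y)) -> periodic g a.
Proof.
move=> hg y; apply/eqP; rewrite -subr_eq0; apply/eqP/bd0P => e e0.
have [h ph hh] := hg (e / 2) ltac:(by rewrite divr_gt0).
have -> : g (y + a) - g y = (h y - g y) - (h (y + a) - g (y + a)) by rewrite ph; ring.
by rewrite [e]splitr; apply: bdB.
Qed.

End FixedPoint.

(** * Means and antiderivatives *)

Section Mean.
Variable R : realType.
Implicit Types (f g h v w : R -> R[i]) (u : R -> R) (z m : R[i]).

Lemma rintT_derive u u' : (forall y : R, is_derive y 1 u (u' y)) -> continuous u' ->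
  rintT u' = u (2 * pi) - u 0.
Proof.
move=> du cu'; rewrite /rintT /Rintegral.
rewrite (@continuous_FTC2 R u' u 0 (2 * pi)) //.
- exact: pi2_gt0.
- exact: continuous_subspaceT.
- have cu := is_derive_continuous du.
  split => [x _||]; first by have [] := du x.
    by apply: cvg_at_right_filter; exact: cu.
  by apply: cvg_at_left_filter; exact: cu.
- by move=> x _; rewrite derive1E; have [_ ->] := du x.
Qed.

Lemma cintT_cder f f' : cder f f' -> ccont f' -> cintT f' = f (2 * pi) - f 0.
Proof.
move=> df [c1 c2]; rewrite /cintT.
rewrite (rintT_derive (fun y => (df y).1) c1) (rintT_derive (fun y => (df y).2) c2).
by apply: eq_complexP; rewrite !ReImE.
Qed.

Lemma cintT_cder_periodic f f' : cder f f' -> ccont f' -> periodic f (2 * pi) -> cintT f' = 0.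
Proof.
by move=> df cf pf; rewrite (cintT_cder df cf) -[2 * pi]add0r pf subrr.
Qed.

Definition mean f := ((2 * pi)^-1)%:C * cintT f.

Lemma pi2_neq0 : (2 * pi)%:C != 0 :> R[i].
Proof. by rewrite eq_complex /= negb_and gt_eqF ?pi2_gt0. Qed.

Lemma mean_cder f f' : cder f f' -> ccont f' -> (2 * pi)%:C * mean f' = f (2 * pi) - f 0.
Proof.
move=> df cf; rewrite /mean mulrA -rmorphM /= divff ?mul1r ?gt_eqF ?pi2_gt0 //.
exact: cintT_cder.
Qed.

Lemma mean_cder_periodic f f' : cder f f' -> ccont f' -> periodic f (2 * pi) -> mean f' = 0.
Proof. by move=> df cf pf; rewrite /mean (cintT_cder_periodic df) // mulr0. Qed.

(** Means of continuous functions are computed through primitives, so linearity follows from the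
    fundamental theorem without integrability conditions. *)
Lemma meanP f f' z : cder f f' -> ccont f' ->
  f (2 * pi) - f 0 = (2 * pi)%:C * z -> mean f' = z.
Proof. by move=> df cf; rewrite -(mean_cder df cf) => /(mulfI pi2_neq0). Qed.

Lemma meanD f g : ccont f -> ccont g -> mean (fun y => f y + g y) = mean f + mean g.
Proof.
move=> cf cg; have [F dF] := exists_cprimitive cf; have [G dG] := exists_cprimitive cg.
apply: meanP (cderD dF dG) (ccontD cf cg) _.
by rewrite [RHS]mulrDr (mean_cder dF cf) (mean_cder dG cg); ring.
Qed.

Lemma meanZ z f : ccont f -> mean (fun y => z * f y) = z * mean f.
Proof.
move=> cf; have [F dF] := exists_cprimitive cf.
apply: meanP (cderZ z dF) (ccontZ z cf) _.
by rewrite mulrCA (mean_cder dF cf); ring.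
Qed.

Lemma mean_cst z : mean (fun=> z) = z.
Proof.
have d : cder (fun y => z * (y%:C)) (fun=> z).
  apply: eq_cder (cderZ z (@cder_real R id (fun=> 1) (fun y => is_derive_id y 1))) => y.
  by rewrite mulr1.
by apply: meanP d (ccont_cst _) _; rewrite mulr0 subr0 mulrC.
Qed.

Lemma meanB f g : ccont f -> ccont g -> mean (fun y => f y - g y) = mean f - mean g.
Proof.
move=> cf cg.
have -> : (fun y => f y - g y) = (fun y => f y + -1 * g y).
  by apply/funext => y; rewrite mulN1r.
by rewrite meanD ?meanZ ?mulN1r //; exact: ccontZ.
Qed.

Lemma is_derive_bound u u' d (x y : R) : (forall y : R, is_derive y 1 u (u' y)) ->
  (forall y, `|u' y| <= d) -> x <= y -> `|u y - u x| <= d * (y - x).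
Proof.
move=> du hd xy.
have [c _ ->] := @MVT_segment R u u' x y xy (fun x _ => du x)
  (continuous_subspaceT (is_derive_continuous du)).
by rewrite normrM (ger0_norm (x := y - x)) ?subr_ge0 // ler_wpM2r ?subr_ge0.
Qed.

Lemma cder_bound f f' d (x y : R) : cder f f' -> (forall y, bd d (f' y)) -> x <= y ->
  bd (d * (y - x)) (f y - f x).
Proof.
move=> df hd xy; split; rewrite !ReImE.
- apply: (@is_derive_bound (fun t => complex.Re (f t)) (fun t => complex.Re (f' t))) => //.
  + by move=> t; apply (df t).1.
  + by move=> t; apply (hd t).1.
- apply: (@is_derive_bound (fun t => complex.Im (f t)) (fun t => complex.Im (f' t))) => //.
  + by move=> t; apply (df t).2.
  + by move=> t; apply (hd t).2.
Qed.

Lemma mean_bd f d : ccont f -> (forall y, bd d (f y)) -> bd d (mean f).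
Proof.
move=> cf hd; have [F dF] := exists_cprimitive cf.
have p0 := @pi2_gt0 R.
have := cder_bound dF hd (ltW p0); rewrite -(mean_cder dF cf).
rewrite /bd !ReImE /= !mul0r subr0 addr0 !(normrM (2 * pi)) (ger0_norm (ltW p0)).
by move=> [a b]; split; rewrite -(ler_pM2l p0) mulrC; lra.
Qed.

(** A primitive grows over one period by 2 pi times the mean of h, that is, by 0; subtracting its
    own mean normalizes it. *)
Lemma periodic_antiderivative h : ccont h -> periodic h (2 * pi) -> mean h = 0 ->
  exists v, [/\ periodic v (2 * pi), cder v h & mean v = 0].
Proof.
move=> ch ph mh; have [F dF] := exists_cprimitive ch.
exists (fun y => F y - mean F); split.
- move=> y; congr (_ - _).
  have E : cder (fun y => F (y + 2 * pi) - F y) (fun=> 0).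
    by apply: eq_cder (cderB (cder_shift (2 * pi) dF) dF) => t; rewrite ph subrr.
  apply/eqP; rewrite -subr_eq0 (cder0_cst E y 0) add0r.
  by rewrite -(mean_cder dF ch) mh mulr0.
- by apply: eq_cder (cderB dF (cder_cst (mean F))) => t; rewrite subr0.
- rewrite meanB ?mean_cst ?subrr //; [exact: cder_ccont dF|exact: ccont_cst].
Qed.

(** Within one period v differs from v(0) by at most 2 pi d; averaging this, with mean v = 0, bounds
    v(0) by the same amount. *)
Lemma antiderivative_bound h v d : periodic v (2 * pi) -> cder v h -> mean v = 0 ->
  (forall y, bd d (h y)) -> forall y, bd (4 * pi * d) (v y).
Proof.
move=> pv dv mv hd.
have d0 := bd_ge0 (hd 0).
have cv := cder_ccont dv.
have B y : bd (2 * pi * d) (v y - v 0).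
  have [y0 [/andP[y00 y02] ->//]] := periodic_reduce y.
  apply: bdW (cder_bound dv hd y00); rewrite subr0 mulrC.
  by apply: ler_wpM2r.
have B0 : bd (2 * pi * d) (v 0).
  have := mean_bd (ccontB cv (ccont_cst (v 0))) B.
  by rewrite meanB ?mv ?mean_cst ?sub0r //; [move/bdN; rewrite opprK|exact: ccont_cst].
move=> y; have -> : v y = (v y - v 0) + v 0 by ring.
by apply: bdW (bdD (B y) B0); lra.
Qed.

End Mean.

(** * The fundamental lemma of the calculus of variations on the circle *)

Section TestFunctions.
Variable R : realType.
Implicit Types (u : R -> R).
Notation mu := (@lebesgue_measure R).

Lemma measurable_EFin_lebesgue (D : set R) u : measurable_fun D u ->
  @measurable_fun _ _ (measurableTypeR R) (\bar R) D (EFin \o u).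
Proof. by move=> mu_u; exact: (@measurable_EFinP _ (measurableTypeR R) R D u).2. Qed.

Lemma integrable_measurable (D : set R) u : mu.-integrable D (EFin \o u) ->
  measurable_fun D u.
Proof.
by move=> /integrableP[h _]; exact: (@measurable_EFinP _ (measurableTypeR R) R D u).1.
Qed.

(** The translated measure has the right values on half-open intervals, which determine Lebesgue
    measure. *)
Lemma lebesgue_measure_shift (a : R) (A : set (measurableTypeR R)) : measurable A ->
  pushforward mu (fun x : R => x + a : measurableTypeR R) A = mu A.
Proof.
move=> mA; apply/esym/lebesgue_measure_unique => //=.
  by apply: measurable_funD => //; exact: measurable_cst.
move=> _ _ [[c d]] _ <-; rewrite /pushforward.
have -> : (fun x : R => x + a) @^-1` `]c, d] = `]c - a, d - a]%classic.
  by apply/seteqP; split => x /=; rewrite !in_itv /= ltrBlDr lerBrDr.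
rewrite !lebesgue_measure_itv /= !lte_fin ltrD2r.
by case: ifP => // _; rewrite -!EFinD; congr EFin; ring.
Qed.

Lemma negligible_shift (a : R) (A : set R) : mu.-negligible A ->
  mu.-negligible [set x | A (x + a)].
Proof.
move=> [N [mN N0 AN]]; exists ((fun x : R => x + a) @^-1` N); split.
- rewrite -[X in measurable X]setTI.
  have : measurable_fun [set: R] (fun x : R => x + a) by apply: measurable_funD => //; exact: measurable_cst.
  by apply => //.
- by rewrite -N0 -(lebesgue_measure_shift a mN).
- by move=> x /AN.
Qed.

Lemma negligible_pt (a : R) : mu.-negligible [set a].
Proof. by apply/negligibleP => //; exact: lebesgue_measure_set1. Qed.

(** The exceptional set is covered by countably many translates of a null set: the exceptional
    points of the open period together with its two end points. *)
Lemma periodic_ae (u : R -> R) : periodic u (2 * pi) ->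
  {ae mu, forall y, 0 < y -> y < 2 * pi -> u y = 0} -> {ae mu, forall y, u y = 0}.
Proof.
move=> pu hN; pose B := ~` [set y | 0 < y -> y < 2 * pi -> u y = 0].
have {}hN : mu.-negligible B by exact: hN.
have hS : mu.-negligible (B `|` ([set 0] `|` [set 2 * pi])).
  by apply: negligibleU => //; apply: negligibleU; exact: negligible_pt.
set S := B `|` _ in hS.
have hU : mu.-negligible (\bigcup_n ([set x | S (x + (2 * pi) *+ n)] `|`
                                     [set x | S (x - (2 * pi) *+ n)])).
  by apply: negligible_bigcup => n; apply: negligibleU; exact: negligible_shift.
suff : mu.-negligible (~` [set y | u y = 0]) by [].
apply: negligibleS hU => y /= uy.
have key y0 : 0 <= y0 <= 2 * pi -> u y = u y0 -> S y0.
  move=> /andP[h0 h2] E.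
  have [->|n0] := eqVneq y0 0; first by right; left.
  have [->|n2] := eqVneq y0 (2 * pi); first by right; right.
  left => /= H; apply: uy; rewrite E; apply: H; first by rewrite lt_def n0.
  by rewrite lt_def eq_sym n2.
have p0 := @pi2_gt0 R.
have := floor_itv (y / (2 * pi)).
rewrite ler_pdivlMr // ltr_pdivrMr // intrD => /andP[].
case: (Num.floor _) => n a b.
- exists n => //; right => /=; apply: key; last by rewrite -[y in LHS](subrK ((2 * pi) *+ n)) (periodicn pu).
  by move: a b; rewrite -mulr_natl /=; lra.
(* The floor is -(n + 1) in this case, so n + 1 periods are added. *)
- exists n.+1 => //; left => /=; apply: key; last by rewrite (periodicn pu).
  by move: a b; rewrite NegzE mulrNz -mulr_natl /=; lra.
Qed.

Lemma sin_half_sign (x y : R) : 0 < x < 2 * pi -> 0 < y < 2 * pi ->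
  (y < x -> 0 < sin (y / 2) * sin ((x - y) / 2)) /\
  (x < y -> sin (y / 2) * sin ((x - y) / 2) < 0).
Proof.
move=> hx hy.
have s1 : 0 < sin (y / 2) by apply: sin_gt0_pi; lra.
split => h.
- by apply: mulr_gt0 => //; apply: sin_gt0_pi; lra.
- rewrite pmulr_rlt0 // -oppr_gt0 -sinN; apply: sin_gt0_pi; lra.
Qed.

Lemma continuous_Rinv (w : R -> R) : continuous w -> (forall y, w y != 0) ->
  continuous (fun y => (w y)^-1).
Proof. by move=> cw w0 y; exact: cvgV (w0 y) (cw y). Qed.

Lemma is_derive_affine_sin (a b y : R) :
  is_derive y 1 (fun y => sin (a * y + b)) (cos (a * y + b) * a).
Proof.
have L : is_derive y 1 (fun y : R => a * y + b) a.
  refine (eq_is_derive _ (is_derive_add (is_derive_mul (is_derive_cst a y 1)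
    (is_derive_id y 1)) (is_derive_cst b y 1))).
  by rewrite mul0r add0r mulr1 addr0.
exact: (@is_derive1_comp R sin (fun y : R => a * y + b) y _ _ (is_derive_sin _) L).
Qed.

Lemma continuous_affine_cos (a b : R) : continuous (fun y => cos (a * y + b)).
Proof.
move=> y; apply: (@continuous_comp _ _ _ (fun y => a * y + b) cos); last exact: continuous_cos.
apply: (@continuous_add R (fun y => a * y) (fun=> b)).
  apply: (@continuous_mul R (fun=> a) (fun y => y)) => t; [exact: cvg_cst|exact: cvg_id].
by move=> t; exact: cvg_cst.
Qed.

Lemma atan_cvg_sign (t : R) : t != 0 ->
  atan (n%:R * t) @[n --> \oo] --> (if 0 < t then pi / 2 else - (pi / 2)).
Proof.
move=> t0.
have pos (s : R) : 0 < s -> atan (n%:R * s) @[n --> \oo] --> pi / 2.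
  move=> s0; apply: (cvg_comp (fun n : nat => n%:R * s) (@atan R) _ (@cvgy_atan R)).
  apply/cvgryPge => M; near=> n.
  rewrite -ler_pdivrMr //; near: n; exact: nbhs_infty_ger.
case: ifPn => [/pos//|]; rewrite -leNgt => tle.
have : 0 < - t by rewrite oppr_gt0 lt_def eq_sym t0.
move=> /pos/cvgN; apply: cvg_trans; apply: near_eq_cvg; near=> n => /=.
by rewrite opprfctE /= mulrN atanN opprK.
Unshelve. all: by end_near.
Qed.

(* On [0, 2 pi], sin(y/2) sin((x-y)/2) is positive on (0, x) and negative on
   (x, 2 pi), and it is 2 pi-periodic; hence the smooth periodic functions
   atan (n sin(y/2) sin((x-y)/2)) + pi/2 tend to pi on (0, x) and to 0 on
   (x, 2 pi). *)
Lemma primitive_eq0_of_test u : measurable_fun [set: R] u ->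
  mu.-integrable `[0, 2 * pi] (EFin \o u) ->
  (forall eta eta' : R -> R, (forall y : R, is_derive y 1 eta (eta' y)) -> continuous eta' ->
     periodic eta (2 * pi) -> rintT (fun y => u y * eta y) = 0) ->
  forall x : R, 0 < x < 2 * pi -> Rintegral mu `[0, x] u = 0.
Proof.
move=> mu_u iu test x hx.
pose q (y : R) := sin (y / 2) * sin ((x - y) / 2).
pose q' (y : R) := (cos (y / 2) / 2) * sin ((x - y) / 2)
                    + sin (y / 2) * (cos ((x - y) / 2) * (- 1 / 2)).
have E1 : (fun y : R => sin (y / 2)) = (fun y => sin (1 / 2 * y + 0)).
  by apply/funext => y; congr sin; lra.
have E2 : (fun y : R => sin ((x - y) / 2)) = (fun y => sin ((- 1 / 2) * y + x / 2)).
  by apply/funext => y; congr sin; lra.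
have d1 (y : R) : is_derive y 1 (fun y : R => sin (y / 2)) (cos (y / 2) / 2).
  rewrite E1; refine (eq_is_derive _ (is_derive_affine_sin (1/2) 0 y)).
  by rewrite mul1r; congr (cos _ * _); lra.
have d2 (y : R) : is_derive y 1 (fun y : R => sin ((x - y) / 2)) (cos ((x - y) / 2) * (- 1 / 2)).
  rewrite E2; refine (eq_is_derive _ (is_derive_affine_sin (- 1/2) (x / 2) y)).
  by congr (cos _ * _); lra.
have dq (y : R) : is_derive y 1 q (q' y) by exact: is_derive_mul (d1 y) (d2 y).
have cst (a : R) : continuous (fun _ : R => a) by move=> t; exact: cvg_cst.
have c1 : continuous (fun y : R => cos (y / 2)).
  rewrite (_ : (fun y => _) = (fun y => cos (1 / 2 * y + 0))); first exact: continuous_affine_cos.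
  by apply/funext => y; congr cos; lra.
have c2 : continuous (fun y : R => cos ((x - y) / 2)).
  rewrite (_ : (fun y => _) = (fun y => cos ((- 1 / 2) * y + x / 2))); first exact: continuous_affine_cos.
  by apply/funext => y; congr cos; lra.
have cq' : continuous q'.
  apply: continuous_add; apply: continuous_mul.
  - exact: continuous_mul.
  - exact: is_derive_continuous d2.
  - exact: is_derive_continuous d1.
  - exact: continuous_mul.
have cq := is_derive_continuous dq.
have pq : periodic q (2 * pi).
  move=> y; rewrite /q.
  have -> : (y + 2 * pi) / 2 = y / 2 + pi by lra.
  have -> : (x - (y + 2 * pi)) / 2 = (x - y) / 2 - pi by lra.
  by rewrite sinDpi sinB cospi sinpi; ring.
pose eta (n : nat) (y : R) := atan (n%:R * q y) + pi / 2.
have deta n (y : R) : is_derive y 1 (eta n) ((1 + (n%:R * q y) ^+ 2)^-1 * (n%:R * q' y)).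
  have L : is_derive y 1 (fun y : R => n%:R * q y) (n%:R * q' y).
    refine (eq_is_derive _ (is_derive_mul (is_derive_cst (n%:R : R) y 1) (dq y))).
    by rewrite mul0r add0r.
  have := @is_derive1_comp R atan (fun y : R => n%:R * q y) y _ _ (is_derive1_atan _) L.
  move=> H; refine (eq_is_derive _ (is_derive_add H (is_derive_cst (pi / 2) y 1))).
  by rewrite addr0.
have t0 n : rintT (fun y => u y * eta n y) = 0.
  apply: (test _ _ (deta n)).
  - apply: continuous_mul; last exact: continuous_mul.
    apply: continuous_Rinv.
      apply: continuous_add => //.
      rewrite (_ : (fun y => _) = (fun y => (n%:R * q y) * (n%:R * q y))) //.
      by apply: continuous_mul; exact: continuous_mul.
    by move=> y; rewrite gt_eqF // ltr_wpDr // sqr_ge0.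
  - by move=> y; rewrite /eta pq.
(* The limit of [eta n] as a function of q. With the value pi / 2 at the zeros of q the convergence
   holds at every point. *)
pose s (t : R) : R := if t == 0 then pi / 2 else if 0 < t then pi else 0.
have ceta n : continuous (eta n) by exact: is_derive_continuous (deta n).
have eta_lim y : eta n y @[n --> \oo] --> s (q y).
  rewrite /eta /s; have [->|q0] := eqVneq (q y) 0.
    have -> : (fun n : nat => atan (n%:R * 0 : R) + pi / 2) = (fun=> pi / 2).
      by apply/funext => n; rewrite mulr0 atan0 add0r.
    exact: cvg_cst.
  have := cvgD (atan_cvg_sign q0) (@cvg_cst _ (pi / 2 : R) _ \oo _).
  by case: ifP => _; rewrite ?addNr -?splitr; apply.
have eta_bd n y : `|eta n y| <= pi.
  have := atan_gtNpi2 (n%:R * q y); have := atan_ltpi2 (n%:R * q y).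
  by rewrite /eta ler_norml; have := pi_gt0 R; lra.
have mI : measurable (`[0, 2 * pi] : set (measurableTypeR R)) by [].
have meas n : measurable_fun `[0, 2 * pi] (fun y => u y * eta n y).
  apply: measurable_funM; first exact: measurable_funTS.
  by apply: measurable_funTS; exact: continuous_measurable_fun.
(* Dominating function, since each [eta n] takes values between 0 and pi. *)
have iu' : mu.-integrable `[0, 2 * pi] (fun y => (pi * `|u y|)%:E).
  have := integrableZl mI pi (integrable_abse iu).
  by apply: eq_integrable.
have ip n : mu.-integrable `[0, 2 * pi] (fun y => (u y * eta n y)%:E).
  apply: le_integrable iu' => //; first exact: (measurable_EFin_lebesgue (meas n)).
  move=> y _ /=; rewrite lee_fin [leRHS]ger0_norm ?mulr_ge0 ?pi_ge0 // normrM mulrC.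
  by apply: ler_wpM2r.
have ucvg y : (u y * eta n y)%:E @[n --> \oo] --> (u y * s (q y))%:E.
  apply: cvg_EFin; first by near=> n.
  by apply: cvgM; [exact: cvg_cst|exact: eta_lim].
have lim0 : (\int[mu]_(y in `[0%R, (2 * pi)%R]) (u y * s (q y))%:E)%E = 0%E.
  have H := @dominated_cvg _ _ R mu `[0, 2 * pi] mI (fun n y => (u y * eta n y)%:E)
    (fun y => (u y * s (q y))%:E) (fun y => (pi * `|u y|)%:E).
  have : (\int[mu]_(y in `[0%R, (2 * pi)%R]) (u y * eta n y)%:E)%E @[n --> \oo]
    --> (\int[mu]_(y in `[0%R, (2 * pi)%R]) (u y * s (q y))%:E)%E.
    apply: H => //.
    - by move=> n; exact: (measurable_EFin_lebesgue (meas n)).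
    - move=> n y _ /=; rewrite lee_fin normrM mulrC.
      by apply: ler_wpM2r.
  have -> : (fun n => (\int[mu]_(y in `[0%R, (2 * pi)%R]) (u y * eta n y)%:E)%E) = (fun=> 0%E).
    apply/funext => n; have := t0 n; rewrite /rintT /Rintegral => e.
    by rewrite -[LHS]fineK ?e //; exact: integrable_fin_num.
  move=> /cvg_lim => <- //; exact: lim_cst.
(* On [0, 2 pi] the limit is pi times the indicator of [0, x] away from the zeros 0, x and 2 pi of
   q. *)
have pin : Rintegral mu `[0, 2 * pi] (fun y => (pi * u y) * \1_(`[0, x]%classic) y) = 0.
  rewrite /Rintegral; rewrite -[RHS]/(fine 0%E) -lim0; congr fine.
  apply: ae_eq_integral => //.
  - apply: measurable_EFin_lebesgue; apply: measurable_funM.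
      by apply: measurable_funM => //; exact: measurable_funTS.
    exact: measurable_indic.
  - apply: (@emeasurable_fun_cvg _ _ _ `[0, 2 * pi] (fun n y => (u y * eta n y)%:E)) => //.
    by move=> n; exact: (measurable_EFin_lebesgue (meas n)).
  - have hN : mu.-negligible ([set 0] `|` ([set x] `|` [set 2 * pi])).
      by apply: negligibleU; [|apply: negligibleU]; exact: negligible_pt.
    apply: negligibleS hN => y /=; apply: contra_notP => hy.
    rewrite in_itv /= => /andP[y0 y2].
    have n0 : y != 0 by apply/eqP => e; apply: hy; left.
    have nx : y != x by apply/eqP => e; apply: hy; right; left.
    have n2 : y != 2 * pi by apply/eqP => e; apply: hy; right; right.
    have hy' : 0 < y < 2 * pi by rewrite !lt_def n0 y0 eq_sym n2.
    have [A B] := sin_half_sign hx hy'.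
    rewrite indicE /s; congr EFin; case: (ltgtP y x) => [yx|xy|e]; last by rewrite e eqxx in nx.
    + have := A yx; rewrite -/(q y) => qp; rewrite gt_eqF // qp mem_set ?mulr1 1?mulrC //=.
      by rewrite in_itv /= y0 ltW.
    + have := B xy; rewrite -/(q y) => qn; rewrite lt_eqF // ltNge (ltW qn) /= memNset ?mulr0 //=.
      by rewrite in_itv /= => /andP[_]; rewrite leNgt xy.
have : Rintegral mu `[0, x] (fun y => pi * u y) = 0.
  rewrite -[RHS]pin (_ : (fun y => pi * u y * _) = ((fun y => pi * u y) \_ `[0, x])); last first.
    apply/funext => y; rewrite patchE indicE; case: ifP => _; by rewrite ?mulr1 ?mulr0.
  rewrite -Rintegral_mkcondr; congr Rintegral.
  apply/seteqP; split => y /=; rewrite !in_itv /=; last by case.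
  by move=> /andP[y0 yx]; split; rewrite y0 //=; lra.
rewrite RintegralZl //; last first.
  by apply: integrableS iu => // y /=; rewrite !in_itv /= => /andP[-> yx] /=; lra.
by move=> /eqP; rewrite mulf_eq0 gt_eqF ?pi_gt0 //= => /eqP.
Unshelve. all: by end_near.
Qed.

(** The indefinite integral of u vanishes on (0, 2 pi), and by Lebesgue differentiation its
    derivative is u almost everywhere. *)
Lemma ae_eq0_of_test u : periodic u (2 * pi) -> measurable_fun [set: R] u ->
  mu.-integrable `[0, 2 * pi] (EFin \o u) ->
  (forall eta eta' : R -> R, (forall y : R, is_derive y 1 eta (eta' y)) -> continuous eta' ->
     periodic eta (2 * pi) -> rintT (fun y => u y * eta y) = 0) ->
  {ae mu, forall y, u y = 0}.
Proof.
move=> pu mu_u iu test; apply: periodic_ae => //.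
have prim := primitive_eq0_of_test mu_u iu test.
(* Extended by zero, u is integrable on the line, so the indefinite integral can start at minus
   infinity. *)
pose f := u \_ `[0, 2 * pi].
have intf : mu.-integrable [set: R] (EFin \o f).
  by rewrite /f -restrict_EFin; apply/integrable_restrict => //=; rewrite setTI.
have intf' y : mu.-integrable `]-oo, y] (EFin \o f) by apply: integrableS intf.
have locf : locally_integrable [set: R] f.
  split => //.
  - exact: integrable_measurable intf.
  - exact: openT.
  - move=> K _ cK; have : mu.-integrable K (EFin \o f).
      by apply: integrableS intf => //; exact: compact_measurable.
    by case/integrableP.
have := FTC1Ny intf' locf; apply: filterS; first exact: (ae_filter_ringOfSetsType mu).
move=> y [_ +] y0 y2.
rewrite /f patchE mem_set /=; last by rewrite in_itv /= !ltW.
move=> <-; rewrite derive1E.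
suff [_ ->] : is_derive y 1 (fun x => Rintegral mu `]-oo, x] f) 0 by [].
apply: near_eq_is_derive (is_derive_cst 0 y 1); near=> x.
have hx : 0 < x < 2 * pi.
  apply/andP; split; near: x; [exact: lt_nbhsr|exact: lt_nbhsl].
rewrite /cst -[LHS](prim x hx) /f -Rintegral_mkcondr; congr Rintegral.
apply/seteqP; split => t /=; rewrite !in_itv /=.
  by move=> /andP[-> tx]; rewrite tx /=; lra.
by move=> [-> /andP[-> _]].
Unshelve. all: by end_near.
Qed.

End TestFunctions.

(** * Weak derivatives and uniqueness of weak solutions *)

Section WeakDerivative.
Variable R : realType.
Implicit Types (f g h v w phi : R -> R[i]) (u : R -> R) (z m : R[i]).
Notation mu := (@lebesgue_measure R).

Definition cint f :=
  mu.-integrable `[0, 2 * pi] (EFin \o (fun y => complex.Re (f y))) /\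
  mu.-integrable `[0, 2 * pi] (EFin \o (fun y => complex.Im (f y))).

Let mI : measurable (`[0, 2 * pi] : set (measurableTypeR R)). Proof. by []. Qed.

Lemma ccont_cint f : ccont f -> cint f.
Proof. by move=> [a b]; split; exact: ccont_integrable. Qed.

Lemma eq_cint f g : (forall y, f y = g y) -> cint f -> cint g.
Proof. by move=> /funext ->. Qed.

Lemma integrable_add (a b : R -> R) :
  mu.-integrable `[0, 2 * pi] (EFin \o a) -> mu.-integrable `[0, 2 * pi] (EFin \o b) ->
  mu.-integrable `[0, 2 * pi] (EFin \o (fun y => a y + b y)).
Proof. by move=> ia ib; apply: eq_integrable (integrableD mI ia ib) => // y _ /=. Qed.

Lemma integrable_scale (k : R) (a : R -> R) : mu.-integrable `[0, 2 * pi] (EFin \o a) ->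
  mu.-integrable `[0, 2 * pi] (EFin \o (fun y => k * a y)).
Proof. by move=> ia; apply: eq_integrable (integrableZl mI k ia) => // y _ /=. Qed.

Lemma cintD f g : cint f -> cint g -> cint (fun y => f y + g y).
Proof.
move=> [a b] [c d]; split.
- by apply: eq_integrable (integrable_add a c) => // y _ /=; rewrite ReImE.
- by apply: eq_integrable (integrable_add b d) => // y _ /=; rewrite ReImE.
Qed.

Lemma cintZ z f : cint f -> cint (fun y => z * f y).
Proof.
move=> [a b]; split.
- apply: eq_integrable (integrable_add (integrable_scale (complex.Re z) a)
    (integrable_scale (- complex.Im z) b)) => // y _ /=.
  by rewrite ReImE mulNr.
- apply: eq_integrable (integrable_add (integrable_scale (complex.Re z) b)
    (integrable_scale (complex.Im z) a)) => // y _ /=.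
  by rewrite ReImE.
Qed.

Lemma rintT_add (a b : R -> R) :
  mu.-integrable `[0, 2 * pi] (EFin \o a) -> mu.-integrable `[0, 2 * pi] (EFin \o b) ->
  rintT (fun y => a y + b y) = rintT a + rintT b.
Proof. exact: RintegralD. Qed.

Lemma rintT_scale (k : R) (a : R -> R) : mu.-integrable `[0, 2 * pi] (EFin \o a) ->
  rintT (fun y => k * a y) = k * rintT a.
Proof. exact: RintegralZl. Qed.

Lemma cintTD f g : cint f -> cint g -> cintT (fun y => f y + g y) = cintT f + cintT g.
Proof.
move=> [a b] [c d]; apply: eq_complexP; rewrite !ReImE /= -rintT_add //.
- by congr rintT; apply/funext => y; rewrite ReImE.
- by congr rintT; apply/funext => y; rewrite ReImE.
Qed.

Lemma cintTZ z f : cint f -> cintT (fun y => z * f y) = z * cintT f.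
Proof.
move=> [a b]; apply: eq_complexP; rewrite !ReImE /=.
- rewrite -mulNr -!rintT_scale // -rintT_add; [|exact: integrable_scale..].
  by congr rintT; apply/funext => y; rewrite ReImE mulNr.
- rewrite -!rintT_scale // -rintT_add; [|exact: integrable_scale..].
  by congr rintT; apply/funext => y; rewrite ReImE.
Qed.

Lemma cintTB f g : cint f -> cint g -> cintT (fun y => f y - g y) = cintT f - cintT g.
Proof.
move=> cf cg; rewrite -[- cintT g]mulN1r -cintTZ // -cintTD //; last exact: cintZ.
by congr cintT; apply/funext => y; rewrite mulN1r.
Qed.

Lemma rintT_ae (a b : R -> R) :
  mu.-integrable `[0, 2 * pi] (EFin \o a) -> mu.-integrable `[0, 2 * pi] (EFin \o b) ->
  {ae mu, forall y, a y = b y} -> rintT a = rintT b.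
Proof.
move=> /integrableP[ma _] /integrableP[mb _] ab.
rewrite /rintT /Rintegral; congr fine; apply: ae_eq_integral => //.
by apply: filterS ab; [exact: (ae_filter_ringOfSetsType mu)|move=> y /= -> _].
Qed.

Lemma cintT_ae f g : cint f -> cint g -> {ae mu, forall y, f y = g y} -> cintT f = cintT g.
Proof.
move=> [a b] [c d] fg; apply: eq_complexP => /=; apply: rintT_ae => //.
- by apply: filterS fg; [exact: (ae_filter_ringOfSetsType mu)|move=> y /= ->].
- by apply: filterS fg; [exact: (ae_filter_ringOfSetsType mu)|move=> y /= ->].
Qed.

Lemma normc_sqr z : Normc.normc z ^+ 2 = complex.Re z ^+ 2 + complex.Im z ^+ 2.
Proof. by case: z => a b /=; rewrite sqr_sqrtr // addr_ge0 ?sqr_ge0. Qed.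

Lemma ccont_L2T f : ccont f -> periodic f (2 * pi) -> L2T f.
Proof.
move=> [a b] pf; split => //.
- exact: continuous_measurable_fun.
- exact: continuous_measurable_fun.
- have := ccont_integrable 0 (2 * pi) (continuous_add (continuous_mul a a) (continuous_mul b b)).
  by apply: eq_integrable => // y _ /=; rewrite normc_sqr !expr2.
Qed.

(** On a bounded interval L^2 is contained in L^1, because |u| <= 1 + u^2. *)
Lemma L2T_cint f : L2T f -> cint f.
Proof.
move=> [_ mr mi iq].
have i1 : mu.-integrable `[0, 2 * pi] (fun y => (1 + Normc.normc (f y) ^+ 2)%:E).
  have c1 : continuous (fun _ : R => 1 : R) by move=> y; exact: cvg_cst.
  exact: (integrable_add (ccont_integrable 0 (2 * pi) c1) iq).
have H u : measurable_fun [set: R] u -> (forall y, u y ^+ 2 <= Normc.normc (f y) ^+ 2) ->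
    mu.-integrable `[0, 2 * pi] (EFin \o u).
  move=> mu_u hu; apply: le_integrable i1 => //.
    by apply: measurable_EFin_lebesgue; exact: measurable_funTS.
  move=> y _ /=; rewrite lee_fin [leRHS]ger0_norm ?addr_ge0 ?sqr_ge0 //.
  apply: le_trans (lerD (lexx 1) (hu y)).
  by have := sqr_ge0 (`|u y| - 1); have := real_normK (num_real (u y)); nra.
split; apply: H => // y; rewrite normc_sqr.
- by rewrite lerDl sqr_ge0.
- by rewrite lerDr sqr_ge0.
Qed.

Lemma integrable_mul_bounded (a b : R -> R) (C : R) : measurable_fun [set: R] a ->
  mu.-integrable `[0, 2 * pi] (EFin \o a) -> continuous b -> (forall y, `|b y| <= C) ->
  mu.-integrable `[0, 2 * pi] (EFin \o (fun y => a y * b y)).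
Proof.
move=> ma ia cb hb.
have i1 : mu.-integrable `[0, 2 * pi] (EFin \o (fun y => C * `|a y|)).
  exact: integrable_scale (integrable_abse ia).
apply: le_integrable i1 => //.
  apply: measurable_EFin_lebesgue; apply: measurable_funM; first exact: measurable_funTS.
  by apply: measurable_funTS; exact: continuous_measurable_fun.
have C0 : 0 <= C by apply: le_trans (hb 0).
move=> y _ /=; rewrite lee_fin [leRHS]ger0_norm ?mulr_ge0 // normrM mulrC.
by apply: ler_wpM2r.
Qed.

Lemma L2T_mul_cint f phi : L2T f -> ccont phi -> periodic phi (2 * pi) ->
  cint (fun y => f y * phi y).
Proof.
move=> Lf cp pp; have [a b] := L2T_cint Lf; have [_ mr mi _] := Lf.
have [C C0 hC] := periodic_bounded cp pp; have [c1 c2] := cp.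
split.
- apply: eq_integrable (integrable_add
    (integrable_mul_bounded mr a c1 (fun y => (hC y).1))
    (integrable_scale (-1) (integrable_mul_bounded mi b c2 (fun y => (hC y).2)))) => // y _ /=.
  by rewrite ReImE mulN1r.
- apply: eq_integrable (integrable_add
    (integrable_mul_bounded mr a c2 (fun y => (hC y).2))
    (integrable_mul_bounded mi b c1 (fun y => (hC y).1))) => // y _ /=.
  by rewrite ReImE.
Qed.

Lemma classCT1P (p : R -> R) : classCT 1 p <->
  [/\ periodic p (2 * pi), forall y : R, is_derive y 1 p (p^`()%classic y) &
      continuous p^`()%classic].
Proof.
split.
- move=> [pp dp cp]; split => // y; apply: DeriveDef; first exact: (dp 0).
  by rewrite derive1E.
- move=> [pp dp cp]; split => // k; rewrite ltnS leqn0 => /eqP -> y.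
  by have [] := dp y.
Qed.

Lemma derive1_eq (p p' : R -> R) : (forall y : R, is_derive y 1 p (p' y)) -> p^`()%classic = p'.
Proof. by move=> dp; apply/funext => y; rewrite derive1E; have [_ ->] := dp y. Qed.

Lemma wderivT_real f g (p p' : R -> R) : is_wderivT f g ->
  (forall y : R, is_derive y 1 p (p' y)) -> continuous p' -> periodic p (2 * pi) ->
  cintT (fun y => f y * (p' y)%:C) = - cintT (fun y => g y * (p y)%:C).
Proof.
move=> [_ _ H] dp cp pp; have := H p; rewrite (derive1_eq dp); apply.
by apply/classCT1P; rewrite (derive1_eq dp).
Qed.

(** The pairing is bilinear, without conjugation, so a complex test function splits into its real
    part plus i times its imaginary part. *)
Lemma wderivT_complex f g phi phi' : is_wderivT f g -> cder phi phi' -> ccont phi' ->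
  periodic phi (2 * pi) -> cintT (fun y => f y * phi' y) = - cintT (fun y => g y * phi y).
Proof.
move=> W dp cp pp; have [Lf Lg _] := W; have [c1 c2] := cp.
have cphi := cder_ccont dp; have [b1 b2] := cphi.
have pp' := cder_periodic dp pp.
have dr := fun y => (dp y).1; have di := fun y => (dp y).2.
have pr : periodic (fun y => complex.Re (phi y)) (2 * pi) by move=> y /=; rewrite pp.
have pi' : periodic (fun y => complex.Im (phi y)) (2 * pi) by move=> y /=; rewrite pp.
have Er := wderivT_real W dr c1 pr.
have Ei := wderivT_real W di c2 pi'.
have S (f0 phi0 : R -> R[i]) : L2T f0 -> ccont phi0 -> periodic phi0 (2 * pi) ->
    cintT (fun y => f0 y * phi0 y) = cintT (fun y => f0 y * (complex.Re (phi0 y))%:C)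
      + 'i%C * cintT (fun y => f0 y * (complex.Im (phi0 y))%:C).
  move=> L0 [k1 k2] p0.
  have i1 : cint (fun y => f0 y * (complex.Re (phi0 y))%:C).
    by apply: L2T_mul_cint => //; [exact: ccont_real|move=> y; rewrite /= p0].
  have i2 : cint (fun y => f0 y * (complex.Im (phi0 y))%:C).
    by apply: L2T_mul_cint => //; [exact: ccont_real|move=> y; rewrite /= p0].
  rewrite -cintTZ // -cintTD //; last exact: cintZ.
  congr cintT; apply/funext => y.
  by rewrite mulrCA -mulrDr; congr (_ * _); exact: complexE.
by rewrite (S f phi' Lf cp pp') (S g phi Lg cphi pp) Er Ei mulrN opprD.
Qed.

Lemma cder_wderivT f f' : cder f f' -> ccont f' -> periodic f (2 * pi) -> is_wderivT f f'.
Proof.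
move=> df cf pf; have cf0 := cder_ccont df; have pf' := cder_periodic df pf.
split; [exact: ccont_L2T|exact: ccont_L2T|].
move=> p /classCT1P[pp dp cp].
have cpr := ccont_real (is_derive_continuous dp).
have cpr' := ccont_real cp.
have D := cderM df (cder_real dp).
have := cintT_cder_periodic D (ccontD (ccontM cf cpr) (ccontM cf0 cpr')).
rewrite cintTD; [|exact/ccont_cint/ccontM..].
by rewrite addrC => H; apply/eqP; rewrite -addr_eq0 H // => y; rewrite pf pp.
Qed.

Lemma L2T_ae_eq_of_test f g : L2T f -> L2T g ->
  (forall p p' : R -> R, (forall y : R, is_derive y 1 p (p' y)) -> continuous p' ->
     periodic p (2 * pi) -> cintT (fun y => f y * (p y)%:C) = cintT (fun y => g y * (p y)%:C)) ->
  {ae mu, forall y, f y = g y}.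
Proof.
move=> Lf Lg T.
have [pf mf1 mf2 _] := Lf; have [pg mg1 mg2 _] := Lg.
have [if1 if2] := L2T_cint Lf; have [ig1 ig2] := L2T_cint Lg.
have H (a b : R -> R) : periodic a (2 * pi) -> periodic b (2 * pi) ->
    measurable_fun [set: R] a -> measurable_fun [set: R] b ->
    mu.-integrable `[0, 2 * pi] (EFin \o a) -> mu.-integrable `[0, 2 * pi] (EFin \o b) ->
    (forall p p' : R -> R, (forall y : R, is_derive y 1 p (p' y)) -> continuous p' ->
     periodic p (2 * pi) -> rintT (fun y => a y * p y) = rintT (fun y => b y * p y)) ->
    {ae mu, forall y, a y = b y}.
  move=> pa pb ma mb ia ib E.
  have : {ae mu, forall y, a y - b y = 0}.
    apply: ae_eq0_of_test => //.
    - by move=> y; rewrite pa pb.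
    - exact: measurable_funB.
    - apply: eq_integrable (integrable_add ia (integrable_scale (-1) ib)) => // y _ /=.
      by rewrite mulN1r.
    - move=> p p' dp cp pp; have := E p p' dp cp pp.
      have cpp := is_derive_continuous dp.
      have [C _ hC] := periodic_bounded (ccont_real cpp) (fun y => congr1 _ (pp y)).
      have ja := integrable_mul_bounded ma ia cpp (fun y => (hC y).1).
      have jb := integrable_mul_bounded mb ib cpp (fun y => (hC y).1).
      move=> /eqP; rewrite -subr_eq0 => /eqP E0.
      rewrite -[RHS]E0 -mulN1r -rintT_scale // -rintT_add //; last exact: integrable_scale.
      by congr rintT; apply/funext => y; ring.
  apply: filterS; first exact: (ae_filter_ringOfSetsType mu).
  by move=> y /eqP; rewrite subr_eq0 => /eqP.
have R1 (a : R -> R[i]) (p : R -> R) :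
    complex.Re (cintT (fun y => a y * (p y)%:C)) = rintT (fun y => complex.Re (a y) * p y).
  by congr rintT; apply/funext => y; rewrite ReImE /= mulr0 subr0.
have I1 (a : R -> R[i]) (p : R -> R) :
    complex.Im (cintT (fun y => a y * (p y)%:C)) = rintT (fun y => complex.Im (a y) * p y).
  by congr rintT; apply/funext => y; rewrite ReImE /= mulr0 add0r.
have h1 : {ae mu, forall y, complex.Re (f y) = complex.Re (g y)}.
  apply: H => //; [by move=> y; rewrite pf|by move=> y; rewrite pg|].
  by move=> p p' dp cp pp; rewrite -!R1 (T p p').
have h2 : {ae mu, forall y, complex.Im (f y) = complex.Im (g y)}.
  apply: H => //; [by move=> y; rewrite pf|by move=> y; rewrite pg|].
  by move=> p p' dp cp pp; rewrite -!I1 (T p p').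
have FF := ae_filter_ringOfSetsType mu.
by apply: filterS2 h1 h2 => y; exact: eq_complexP.
Qed.

(** Both derivatives have the same pairing with every test function. Almost everywhere equal f and g
    are allowed so that the lemma can be iterated for second derivatives. *)
Lemma wderivT_unique f f' g g' : is_wderivT f f' -> is_wderivT g g' ->
  {ae mu, forall y, f y = g y} -> {ae mu, forall y, f' y = g' y}.
Proof.
move=> Wf Wg fg; have [Lf Lf' _] := Wf; have [Lg Lg' _] := Wg.
apply: L2T_ae_eq_of_test => // p p' dp cp pp.
apply: oppr_inj; rewrite -(wderivT_real Wf dp cp pp) -(wderivT_real Wg dp cp pp).
have pp' : periodic (fun y => (p' y)%:C : R[i]) (2 * pi).
  exact: cder_periodic (cder_real dp) (fun y => congr1 _ (pp y)).
have cp' := ccont_real cp.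
apply: cintT_ae; [exact: L2T_mul_cint|exact: L2T_mul_cint|].
by apply: filterS fg; [exact: (ae_filter_ringOfSetsType mu)|move=> y /= ->].
Qed.

Lemma cder2_is_dyy f f1 f2 : cder f f1 -> cder f1 f2 -> ccont f2 -> periodic f (2 * pi) ->
  is_dyy f f2.
Proof.
move=> d1 d2 c2 pf; exists f1; first exact: cder_wderivT (cder_ccont d2) pf.
exact: cder_wderivT (cder_periodic d1 pf).
Qed.

Lemma dyyP f : H2T f -> is_dyy f (dyy f).
Proof. by move=> [h hh]; apply: (@xgetPex _ (fun=> 0) [set h | is_dyy f h]); exists h. Qed.

Lemma dyy_cder2 f f1 f2 : cder f f1 -> cder f1 f2 -> ccont f2 -> periodic f (2 * pi) ->
  {ae mu, forall y, dyy f y = f2 y}.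
Proof.
move=> d1 d2 c2 pf; have H := cder2_is_dyy d1 d2 c2 pf.
have [g W1 W2] := @dyyP f (ex_intro _ _ H); have [g' W1' W2'] := H.
by apply: wderivT_unique W2 W2' _; apply: wderivT_unique W1 W1' _; exact: aeW.
Qed.

(* Duality: w is tested against p = phi'' - z phi, with phi a classical
   solution, so that only F remains. *)
Lemma weak_solution_test w h phi phi1 z F (p : R -> R) : is_dyy w h ->
  {ae mu, forall y, h y - z * w y = F y} ->
  ccont F -> periodic F (2 * pi) -> continuous p -> periodic p (2 * pi) ->
  periodic phi (2 * pi) -> cder phi phi1 -> cder phi1 (fun y => z * phi y + (p y)%:C) ->
  cintT (fun y => w y * (p y)%:C) = cintT (fun y => F y * phi y).
Proof.
move=> [g W1 W2] hF cF pF cp pp pphi d1 d2.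
have cphi := cder_ccont d1; have cpr := ccont_real cp.
have c2 := ccontD (ccontZ z cphi) cpr.
have p1 := cder_periodic d1 pphi.
have ppr : periodic (fun y => (p y)%:C : R[i]) (2 * pi) by move=> y; rewrite pp.
have [Lw _ _] := W1; have [_ Lh _] := W2.
have E : cintT (fun y => w y * (z * phi y + (p y)%:C)) = cintT (fun y => h y * phi y).
  rewrite (wderivT_complex W1 d2 c2 p1) (wderivT_complex W2 d1 (cder_ccont d2) pphi).
  by rewrite opprK.
have i1 := L2T_mul_cint Lw cphi pphi; have i2 := L2T_mul_cint Lw cpr ppr.
have i3 := L2T_mul_cint Lh cphi pphi.
have {}E : z * cintT (fun y => w y * phi y) + cintT (fun y => w y * (p y)%:C) =
    cintT (fun y => h y * phi y).
  rewrite -E -cintTZ // -cintTD //; last exact: cintZ.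
  by congr cintT; apply/funext => y; ring.
transitivity (cintT (fun y => h y * phi y - z * (w y * phi y))).
  by rewrite cintTB ?cintTZ -?E //; [ring|exact: cintZ].
apply: cintT_ae.
- apply: eq_cint (cintD i3 (cintZ (- z) i1)) => y; ring.
- exact/ccont_cint/ccontM.
- apply: filterS hF; first exact: (ae_filter_ringOfSetsType mu).
  by move=> y /= <-; ring.
Qed.

Lemma weak_solution_unique m w h F psi : complex.Re m != 0 -> is_dyy w h ->
  {ae mu, forall y, h y - (m * m) * w y = F y} -> ccont F -> periodic F (2 * pi) ->
  solves2 (m * m) F psi -> {ae mu, forall y, w y = psi y}.
Proof.
move=> m0 Dw hF cF pF Spsi; have [ppsi [psi1 e1 e2]] := Spsi.
have cpsi := cder_ccont e1.
have Dpsi := cder2_is_dyy e1 e2 (ccontD (ccontZ _ cpsi) cF) ppsi.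
have [g [Lw _ _] _] := Dw.
apply: L2T_ae_eq_of_test => //; first exact: ccont_L2T.
move=> p p' dp cp pp; have cp0 := is_derive_continuous dp.
(* For the bilinear pairing d_yy is symmetric, so the dual equation has the same parameter m^2, not
   its conjugate. *)
have [phi [pphi [phi1 d1 d2]]] := periodic_ode2 m0 (ccont_real cp0) (fun y => congr1 _ (pp y)).
rewrite (weak_solution_test Dw hF cF pF cp0 pp pphi d1 d2).
rewrite (weak_solution_test Dpsi _ cF pF cp0 pp pphi d1 d2) //.
by apply: aeW => y; ring.
Qed.

(** The classical solution shows that the choice in [resolventT] is not the default one, and
    uniqueness identifies it. Membership in L^2 is kept because the norm of the chosen
    representative is later compared as an integral. *)
Lemma resolventT_solves2 m F psi : complex.Re m != 0 -> ccont F -> periodic F (2 * pi) ->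
  solves2 (m * m) F psi ->
  L2T (resolventT (m * m) F) /\ {ae mu, forall y, resolventT (m * m) F y = psi y}.
Proof.
move=> m0 cF pF Spsi; have [ppsi [psi1 e1 e2]] := Spsi.
have c2 := ccontD (ccontZ (m * m) (cder_ccont e1)) cF.
pose P := [set w | H2T w /\ (fun y => dyy w y - (m * m) * w y) = F %[ae mu]].
have [] : P (resolventT (m * m) F).
  apply: (@xgetPex _ (fun=> 0) P); exists psi; split.
    by exists (fun y => m * m * psi y + F y); exact: cder2_is_dyy e1 e2 c2 ppsi.
  have := dyy_cder2 e1 e2 c2 ppsi; apply: filterS; first exact: (ae_filter_ringOfSetsType mu).
  by move=> y -> _; ring.
move=> /dyyP Dw hF; split; first by have [g []] := Dw.
apply: weak_solution_unique Dw _ cF pF Spsi => //.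
by apply: filterS hF; [exact: (ae_filter_ringOfSetsType mu)|move=> y; apply].
Qed.

End WeakDerivative.

Lemma eps_small (R : realFieldType) (A B : R) : 0 <= A -> 0 < B ->
  exists2 e, 0 < e & forall eps, 0 < eps -> eps < e -> A * eps <= B.
Proof.
move=> A0 B0; have A1 : 0 < A + 1 by lra.
exists (B / (A + 1)); first exact: divr_gt0.
by move=> eps e0; rewrite ltr_pdivlMr // => h; nra.
Qed.

(** * Double primitives with zero mean *)

Section Primitive2.
Variable R : realType.
Implicit Types (f g h phi chi : R -> R[i]).

(** Subtracting the mean makes this solvable for every continuous periodic [g], so the iteration
    need not preserve mean zero; at the fixed point the mean vanishes and phi'' = g. *)
Definition primitive2 g phi := exists phi1,
  [/\ periodic phi (2 * pi), cder phi phi1, cder phi1 (fun y => g y - mean g),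
      mean phi = 0 & mean phi1 = 0].

(** One factor 4 pi per integration, and 2 for the passage from g to g - mean g. *)
Definition cprim2 : R := 4 * pi * (4 * pi * 2).

Lemma cprim2_ge0 : 0 <= cprim2.
Proof. by rewrite !mulr_ge0 ?pi_ge0. Qed.

Lemma primitive2_exists g : ccont g -> periodic g (2 * pi) -> exists phi, primitive2 g phi.
Proof.
move=> cg pg.
have [|||v [pv dv mv]] := @periodic_antiderivative R (fun y => g y - mean g).
- exact: ccontB cg (ccont_cst _).
- by move=> y; rewrite pg.
- by rewrite meanB ?mean_cst ?subrr //; exact: ccont_cst.
have [phi [pphi dphi mphi]] := periodic_antiderivative (cder_ccont dv) pv mv.
by exists phi, v.
Qed.

Lemma primitive2B g h phi chi : ccont g -> ccont h -> primitive2 g phi -> primitive2 h chi ->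
  primitive2 (fun y => g y - h y) (fun y => phi y - chi y).
Proof.
move=> cg ch [phi1 [pp d1 d2 m1 m2]] [chi1 [pc e1 e2 n1 n2]].
exists (fun y => phi1 y - chi1 y); split.
- by move=> y; rewrite pp pc.
- exact: cderB.
- by apply: eq_cder (cderB d2 e2) => y; rewrite meanB //; ring.
- by rewrite meanB ?m1 ?n1 ?subrr //; [exact: cder_ccont d1|exact: cder_ccont e1].
- by rewrite meanB ?m2 ?n2 ?subrr //; [exact: cder_ccont d2|exact: cder_ccont e2].
Qed.

Lemma primitive2_bound g phi d : ccont g -> primitive2 g phi -> (forall y, bd d (g y)) ->
  forall y, bd (cprim2 * d) (phi y).
Proof.
move=> cg [phi1 [pp d1 d2 m1 m2]] hg.
have h1 y : bd (d + d) (g y - mean g) by apply: bdB (hg y) (mean_bd cg hg).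
have h2 := antiderivative_bound (cder_periodic d1 pp) d2 m2 h1.
have -> : cprim2 * d = 4 * pi * (4 * pi * (d + d)) by rewrite /cprim2; ring.
exact: antiderivative_bound pp d1 m1 h2.
Qed.

End Primitive2.

(** * The fixed-point equation *)

(* The stream function is sought as psi = 1 + eps phi with phi of mean zero, and
   the unknown is g = phi''.  The vorticity is - eps^2 + eps (g - eps^2 phi).
   The mean of the eigenvalue equation gives
   lambda = i K - nu eps^2 - i eps^2 <U phi>; inserting this into the rest yields
   g'' - (i K / nu) g = forcing, whose right-hand side contains no derivative of
   g.  Its mean is subtracted in [forcing] to make the equation solvable for an
   arbitrary g; this changes nothing at a fixed point. *)
Section FixedPointEquation.
Variable R : realType.
Variables (U U1 U2 : R -> R) (nu K : R).
Hypothesis pU : periodic U (2 * pi).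
Hypothesis dU : forall y : R, is_derive y 1 U (U1 y).
Hypothesis dU1 : forall y : R, is_derive y 1 U1 (U2 y).
Hypothesis cU2 : continuous U2.
Hypothesis nu_gt0 : 0 < nu.
Implicit Types (f g h phi chi : R -> R[i]).

Let cUc : ccont (fun y => (U y)%:C : R[i]).
Proof. exact: ccont_real (is_derive_continuous dU). Qed.
Let cU1c : ccont (fun y => (U1 y)%:C : R[i]).
Proof. exact: ccont_real (is_derive_continuous dU1). Qed.
Let cU2c : ccont (fun y => (U2 y)%:C : R[i]).
Proof. exact: ccont_real. Qed.
Let dUc : cder (fun y => (U y)%:C : R[i]) (fun y => (U1 y)%:C).
Proof. exact: cder_real. Qed.
Let dU1c : cder (fun y => (U1 y)%:C : R[i]) (fun y => (U2 y)%:C).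
Proof. exact: cder_real. Qed.
Let pUc : periodic (fun y => (U y)%:C : R[i]) (2 * pi).
Proof. by move=> y; rewrite pU. Qed.
Let pU1c : periodic (fun y => (U1 y)%:C : R[i]) (2 * pi).
Proof. exact: cder_periodic dUc pUc. Qed.
Let pU2c : periodic (fun y => (U2 y)%:C : R[i]) (2 * pi).
Proof. exact: cder_periodic dU1c pU1c. Qed.

Definition vort (eps : R) g phi y : R[i] := g y - (eps ^+ 2)%:C * phi y.

Definition meanU phi : R[i] := mean (fun y => (U y)%:C * phi y).

(** What remains of the eigenvalue equation after division by eps: viscosity, the transport U times
    vorticity, the term in U'', the transport of the constant vorticity -eps^2, and the shift of
    lambda by <U phi>. Only the constant i eps^2 <U phi> is left out; subtracting the mean in
    [forcing] restores it. *)
Definition nonlin (eps : R) g phi y : R[i] :=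
  (nu * eps)%:C * g y + 'i%C * ((U y)%:C * vort eps g phi y) - 'i%C * ((U2 y)%:C * phi y)
  - 'i%C * (eps%:C * (U y)%:C) - 'i%C * (eps%:C * (meanU phi * vort eps g phi y)).

Definition forcing (eps : R) g phi y : R[i] :=
  (nu^-1)%:C * (- 'i%C * (U2 y)%:C + eps%:C * (nonlin eps g phi y - mean (nonlin eps g phi))).

Lemma vort_ccont eps g phi : ccont g -> ccont phi -> ccont (vort eps g phi).
Proof. by move=> cg cp; apply: ccontB => //; exact: ccontZ. Qed.

Lemma nonlin_ccont eps g phi : ccont g -> ccont phi -> ccont (nonlin eps g phi).
Proof.
move=> cg cp; have cv := vort_ccont eps cg cp.
apply: ccontB; last by do 3 apply: ccontZ.
apply: ccontB; last by do 2 apply: ccontZ.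
apply: ccontB; last by apply: ccontZ; exact: ccontM.
by apply: ccontD; apply: ccontZ => //; exact: ccontM.
Qed.

Lemma forcing_ccont eps g phi : ccont g -> ccont phi -> ccont (forcing eps g phi).
Proof.
move=> cg cp; apply: ccontZ; apply: ccontD; first exact: ccontZ.
by apply: ccontZ; apply: ccontB (ccont_cst _); exact: nonlin_ccont.
Qed.

Lemma forcing_periodic eps g phi : periodic g (2 * pi) -> periodic phi (2 * pi) ->
  periodic (forcing eps g phi) (2 * pi).
Proof.
by move=> pg pp y; rewrite /forcing /nonlin /vort pg pp (pU2c y) (pUc y).
Qed.

Lemma bd_eps (eps d : R) (z : R[i]) : 0 <= eps <= 1 -> bd d z -> bd d (eps%:C * z).
Proof.
move=> /andP[e0 e1] hz; apply: bdW (bdZ eps hz).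
by rewrite ger0_norm // -[leRHS]mul1r ler_wpM2r // (bd_ge0 hz).
Qed.

Variable M : R.
Hypothesis hMU : forall y, bd M ((U y)%:C : R[i]).
Hypothesis hMU2 : forall y, bd M ((U2 y)%:C : R[i]).

(** Lipschitz constant of [nonlin] on functions bounded by G. The last group is the product of
    [meanU] and [vort], whose two factors vary in turn; the other factors 2 come from [bdM]. *)
Definition nlip (G : R) : R :=
  let C := cprim2 R in
  nu + 2 * (M * (1 + C)) + 2 * (M * C) +
  (2 * (2 * (M * C) * (G + C * G)) + 2 * (2 * (M * (C * G)) * (1 + C))).

Lemma meanU_bd phi d : ccont phi -> (forall y, bd d (phi y)) -> bd (2 * (M * d)) (meanU phi).
Proof. by move=> cp hp; apply: mean_bd; [exact: ccontM|move=> y; exact: bdM]. Qed.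

Lemma meanUB phi chi : ccont phi -> ccont chi ->
  meanU (fun y => phi y - chi y) = meanU phi - meanU chi.
Proof.
move=> cp cc; rewrite /meanU -meanB; [|exact: ccontM..].
by congr mean; apply/funext => t; rewrite mulrBr.
Qed.

Lemma vort_bd eps g phi d : 0 <= eps <= 1 -> ccont g -> primitive2 g phi ->
  (forall y, bd d (g y)) -> forall y, bd (d + cprim2 R * d) (vort eps g phi y).
Proof.
move=> he cg Pg hg y; apply: bdB => //.
have -> : (eps ^+ 2)%:C * phi y = eps%:C * (eps%:C * phi y).
  by rewrite expr2 rmorphM mulrA.
apply: (bd_eps he); apply: (bd_eps he).
exact: primitive2_bound Pg hg y.
Qed.

Lemma primitive2_ccont g phi : primitive2 g phi -> ccont phi.
Proof. by move=> [p1 [_ d _ _ _]]; exact: cder_ccont d. Qed.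

Lemma nonlin_lipschitz eps g h phi chi G d : 0 <= eps <= 1 -> ccont g -> ccont h ->
  primitive2 g phi -> primitive2 h chi ->
  (forall y, bd G (g y)) -> (forall y, bd G (h y)) -> (forall y, bd d (g y - h y)) ->
  forall y, bd (nlip G * d) (nonlin eps g phi y - nonlin eps h chi y).
Proof.
move=> he cg ch Pg Ph hg hh hd y.
have cD := ccontB cg ch; have PD := primitive2B cg ch Pg Ph.
have cphi := primitive2_ccont Pg; have cchi := primitive2_ccont Ph.
have hv := vort_bd he cg Pg hg y.
have hvD := vort_bd he cD PD hd y.
have hpD := primitive2_bound cD PD hd.
have hmD := meanU_bd (ccontB cphi cchi) hpD.
have hm := meanU_bd cchi (primitive2_bound ch Ph hh).
have EmD := meanUB cphi cchi.
have hnu : bd (nu * d) ((nu * eps)%:C * (g y - h y)).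
  rewrite rmorphM /= -mulrA -[nu in X in bd X](ger0_norm (ltW nu_gt0)).
  by apply: bdZ; exact: bd_eps.
(* The quadratic term is split as a b - a' b' = (a - a') b + a' (b - b'); the term - i eps U
   cancels. *)
have -> : nonlin eps g phi y - nonlin eps h chi y =
  (nu * eps)%:C * (g y - h y)
  + 'i%C * ((U y)%:C * vort eps (fun y => g y - h y) (fun y => phi y - chi y) y)
  - 'i%C * ((U2 y)%:C * (phi y - chi y))
  - 'i%C * (eps%:C * (meanU (fun y => phi y - chi y) * vort eps g phi y
     + meanU chi * vort eps (fun y => g y - h y) (fun y => phi y - chi y) y)).
  by rewrite EmD /nonlin /vort; ring.
have := bdB (bdB (bdD hnu (bdi (bdM (hMU y) hvD))) (bdi (bdM (hMU2 y) (hpD y))))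
  (bdi (bd_eps he (bdD (bdM hmD hv) (bdM hm hvD)))).
by apply: bdW; rewrite /nlip /=; lra.
Qed.

Lemma mean0 : mean (fun=> 0) = 0 :> R[i].
Proof. exact: mean_cst. Qed.

(** This is the Lipschitz estimate against g = 0, where [nonlin] reduces to - i eps U. *)
Lemma nonlin_bound eps g phi G : 0 <= eps <= 1 -> ccont g -> primitive2 g phi ->
  (forall y, bd G (g y)) -> forall y, bd (nlip G * G + M) (nonlin eps g phi y).
Proof.
move=> he cg Pg hg y.
have G0 := bd_ge0 (hg 0).
have P0 : primitive2 (fun=> 0) (fun=> 0 : R[i]).
  exists (fun=> 0); split; rewrite ?mean0 //; [exact: cder_cst|].
  by apply: eq_cder (cder_cst 0) => t; rewrite subr0.
have c0 : ccont (fun=> 0 : R[i]) by exact: ccont_cst.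
have hd t : bd G (g t - 0) by rewrite subr0.
have h0 (t : R) : bd G (0 : R[i]) by split; rewrite normr0.
have := nonlin_lipschitz he cg c0 Pg P0 hg h0 hd y.
have hU : bd M ('i%C * (eps%:C * (U y)%:C)) by apply: bdi; exact: bd_eps.
move=> /bdB/(_ hU); congr bd.
by rewrite /nonlin /vort; ring.
Qed.

Variables (m : R[i]) (g0 : R -> R[i]).
Hypothesis m0 : complex.Re m != 0.
Hypothesis Sg0 : solves2 (m * m) (fun y => (nu^-1)%:C * (- 'i%C * (U2 y)%:C)) g0.

(** The iteration runs in the unit ball around the unperturbed solution g0. One estimate, [close],
    gives both the invariance of the ball and the O(eps) distance to g0. *)
Lemma fixed_point_exists : exists2 C : R, 0 <= C & exists2 e, 0 < e &
  forall eps, 0 < eps -> eps < e -> exists g phi,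
    [/\ ccont g, primitive2 g phi, solves2 (m * m) (forcing eps g phi) g &
        forall y, bd (C * eps) (g y - g0 y)].
Proof.
have cg0 := solves2_ccont Sg0; have pg0 := Sg0.1.
have [B B0 hB] := periodic_bounded cg0 pg0.
pose G := B + 1.
have M0 : 0 <= M := bd_ge0 (hMU 0).
have C0 := cprim2_ge0 R.
have G0 : 0 <= G by rewrite /G; lra.
have L0 : 0 <= nlip G.
  by rewrite /nlip; repeat (apply: addr_ge0 || apply: mulr_ge0) => //; exact: ltW.
pose N := nlip G * G + M.
have N0 : 0 <= N by rewrite /N addr_ge0 // mulr_ge0.
pose r := 4 / `|complex.Re m| ^+ 2.
have r0 : 0 <= r by rewrite divr_ge0 ?sqr_ge0.
have nui : 0 <= nu^-1 by rewrite invr_ge0 ltW.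
(* Resolvent bound r, times 1 / nu, times the bound N for [nonlin] and again for its mean. *)
pose C := r * (nu^-1 * (N + N)).
have CC : 0 <= C by apply: mulr_ge0 => //; apply: mulr_ge0 => //; exact: addr_ge0.
have [e1 e10 he1] := eps_small CC (ltr01 : 0 < 1 :> R).
(* [e1] keeps the image in the unit ball, [e2] makes the contraction factor at most 1/2. *)
have [|e2 e20 he2] := @eps_small R (r * (nu^-1 * (nlip G + nlip G))) (1 / 2) _ ltac:(lra).
  by apply: mulr_ge0 => //; apply: mulr_ge0 => //; exact: addr_ge0.
exists C => //; exists (Num.min 1 (Num.min e1 e2)); first by rewrite !lt_min ltr01 e10.
move=> eps eps0; rewrite !lt_min => /and3P[l1 l2 l3].
have he : 0 <= eps <= 1 by rewrite !ltW.
have {}he1 := he1 eps eps0 l2; have {}he2 := he2 eps eps0 l3.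
pose X g := [/\ ccont g, periodic g (2 * pi) & forall y, bd 1 (g y - g0 y)].
have XG g : X g -> forall y, bd G (g y).
  move=> [_ _ h] y; rewrite /G addrC (_ : g y = (g y - g0 y) + g0 y); last by ring.
  exact: bdD.
pose T g g' := exists2 phi, primitive2 g phi & solves2 (m * m) (forcing eps g phi) g'.
have close g phi g' : X g -> primitive2 g phi -> solves2 (m * m) (forcing eps g phi) g' ->
    forall y, bd (C * eps) (g' y - g0 y).
  move=> Xg Pg Sg; have [cg pg hg] := Xg.
  have hn := nonlin_bound he cg Pg (XG _ Xg).
  have cn := nonlin_ccont eps cg (primitive2_ccont Pg).
  have -> : C * eps = r * (nu^-1 * (eps * (N + N))) by rewrite /C; ring.
  apply: (periodic_ode2_bound m0 (solves2B Sg Sg0)) => y.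
  have -> : forcing eps g phi y - (nu^-1)%:C * (- 'i%C * (U2 y)%:C) =
      (nu^-1)%:C * (eps%:C * (nonlin eps g phi y - mean (nonlin eps g phi))).
    by rewrite /forcing; ring.
  have := bdZ nu^-1 (bdZ eps (bdB (hn y) (mean_bd cn hn))).
  by rewrite (ger0_norm nui) (ger0_norm (ltW eps0)).
have [g [cg pg hg] [phi Pg Sg]] : exists2 g, X g & T g g.
  apply: (@uniform_fixpoint R X T 2 g0).
  - by split => // y; rewrite subrr; split; rewrite normr0.
  - move=> g h [_ _ hg] [_ _ hh] y.
    have -> : g y - h y = (g y - g0 y) - (h y - g0 y) by ring.
    exact: bdB.
  - move=> g H; split.
    + by apply: uniform_limit_ccont => e /H[h []]; exists h.
    + by apply: uniform_limit_periodic => e /H[h []]; exists h.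
    + move=> y; split; apply/ler_addgt0Pr => e e0; have [h [_ _ hh] hc] := H e e0.
        have -> : g y - g0 y = (h y - g0 y) - (h y - g y) by ring.
        by apply (bdB (hh y) (hc y)).1.
      have -> : g y - g0 y = (h y - g0 y) - (h y - g y) by ring.
      by apply (bdB (hh y) (hc y)).2.
  - move=> g Xg; have [cg pg hg] := Xg.
    have [phi Pg] := primitive2_exists cg pg; have [_ [pphi _ _ _ _]] := Pg.
    have cphi := primitive2_ccont Pg.
    have [g' Sg] := periodic_ode2 m0 (forcing_ccont eps cg cphi) (forcing_periodic eps pg pphi).
    exists g'; last by exists phi.
    split; [exact: solves2_ccont Sg|exact: Sg.1|].
    by move=> y; apply: bdW (close _ _ _ Xg Pg Sg y).
  - move=> g h g' h' d Xg Xh [phi Pg Sg] [chi Ph Sh] hd y.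
    have [cg pg hg] := Xg; have [ch ph hh] := Xh.
    have d0 := bd_ge0 (hd 0).
    have hl := nonlin_lipschitz he cg ch Pg Ph (XG _ Xg) (XG _ Xh) hd.
    have cn := nonlin_ccont eps cg (primitive2_ccont Pg).
    have cn' := nonlin_ccont eps ch (primitive2_ccont Ph).
    have hm := mean_bd (ccontB cn cn') hl.
    have := @periodic_ode2_bound _ m _ _ (nu^-1 * (eps * (nlip G * d + nlip G * d))) m0 (solves2B Sg Sh).
    move=> H; apply: bdW (H _ y) => [|t].
      by rewrite -/r; have := ler_wpM2r d0 he2; lra.
    have -> : forcing eps g phi t - forcing eps h chi t =
      (nu^-1)%:C * (eps%:C * ((nonlin eps g phi t - nonlin eps h chi t)
         - mean (fun y => nonlin eps g phi y - nonlin eps h chi y))).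
      by rewrite meanB // /forcing; ring.
    have := bdZ nu^-1 (bdZ eps (bdB (hl t) hm)).
    by rewrite (ger0_norm nui) (ger0_norm (ltW eps0)).
exists g, phi; split => //.
by apply: close Pg Sg; split.
Qed.

(** Averaging the equation leaves z times the mean of g, since g'' has mean zero. *)
Lemma mean_eq0_of_solves2 z h g : z != 0 -> ccont h -> mean h = 0 -> solves2 z h g ->
  mean g = 0.
Proof.
move=> z0 ch mh [pg [g1 d1 d2]]; have cg := cder_ccont d1.
have := mean_cder_periodic d2 (ccontD (ccontZ z cg) ch) (cder_periodic d1 pg).
rewrite meanD ?meanZ //; last exact: ccontZ.
by rewrite mh addr0 => /eqP; rewrite mulf_eq0 (negbTE z0) => /eqP.
Qed.

Lemma mean_U2 : mean (fun y => (U2 y)%:C : R[i]) = 0.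
Proof. exact: mean_cder_periodic dU1c cU2c pU1c. Qed.

(** Green's identity: U phi'' - U'' phi is the derivative of the periodic function U phi' - U'
    phi. *)
Lemma mean_parts phi phi1 phi2 : cder phi phi1 -> cder phi1 phi2 -> ccont phi2 ->
  periodic phi (2 * pi) ->
  mean (fun y => (U y)%:C * phi2 y) = mean (fun y => (U2 y)%:C * phi y).
Proof.
move=> d1 d2 c2 pp; have p1 := cder_periodic d1 pp.
have c0 := cder_ccont d1; have c1 := cder_ccont d2.
have D := cderB (cderM dUc d2) (cderM dU1c d1).
have c : ccont (fun y => (U y)%:C * phi2 y - (U2 y)%:C * phi y).
  by apply: ccontB; exact: ccontM.
have {}D : cder (fun y => (U y)%:C * phi1 y - (U1 y)%:C * phi y)
    (fun y => (U y)%:C * phi2 y - (U2 y)%:C * phi y).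
  by apply: eq_cder D => y; ring.
have := mean_cder_periodic D c; rewrite meanB; [|exact: ccontM..].
move=> H; apply/eqP; rewrite -subr_eq0 H // => y.
by rewrite (pUc y) p1 (pU1c y) pp.
Qed.

Hypothesis mU : mean (fun y => (U y)%:C : R[i]) = 0.

(** The forcing has mean zero by construction, hence so has g. In the mean of [nonlin] the terms <U
    g> and <U'' phi> cancel by Green's identity; what survives is exactly the constant that the
    eigenvalue equation requires to be subtracted. *)
Lemma fixed_point_mean eps g phi : m != 0 -> ccont g -> primitive2 g phi ->
  solves2 (m * m) (forcing eps g phi) g ->
  mean g = 0 /\ mean (nonlin eps g phi) = - 'i%C * ((eps ^+ 2)%:C * meanU phi).
Proof.
move=> mn0 cg Pg Sg; have [phi1 [pp d1 d2 mp mp1]] := Pg.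
have cp := cder_ccont d1; have cn := nonlin_ccont eps cg cp.
have mg : mean g = 0.
  apply: mean_eq0_of_solves2 Sg; [by rewrite mulf_neq0|exact: forcing_ccont|].
  have c1 := ccontZ (- 'i%C) cU2c; have c2 := ccontB cn (ccont_cst (mean (nonlin eps g phi))).
  rewrite meanZ; last by apply: ccontD => //; exact: ccontZ.
  rewrite meanD //; last exact: ccontZ.
  rewrite !meanZ // mean_U2 meanB ?mean_cst ?subrr ?mulr0 ?addr0 ?mulr0 //; exact: ccont_cst.
split=> //.
have {}d2 : cder phi1 g by apply: eq_cder d2 => y; rewrite mg subr0.
have cv := vort_ccont eps cg cp.
have mv : mean (vort eps g phi) = 0.
  by rewrite /vort meanB ?meanZ ?mg ?mp ?mulr0 ?subrr //; exact: ccontZ.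
have mUv : mean (fun y => (U y)%:C * vort eps g phi y) =
    mean (fun y => (U2 y)%:C * phi y) - (eps ^+ 2)%:C * meanU phi.
  rewrite -(mean_parts d1 d2 cg pp) /meanU -meanZ; last exact: ccontM.
  rewrite -meanB; [|exact: ccontM|by apply: ccontZ; exact: ccontM].
  by congr mean; apply/funext => y; rewrite /vort; ring.
have b1 := ccontZ (nu * eps)%:C cg.
have b2 := ccontM cUc cv; have b2' := ccontZ 'i%C b2.
have b3 := ccontM cU2c cp; have b3' := ccontZ 'i%C b3.
have b4 := ccontZ eps%:C cUc; have b4' := ccontZ 'i%C b4.
have b5 := ccontZ (meanU phi) cv; have b5' := ccontZ eps%:C b5; have b5'' := ccontZ 'i%C b5'.
have s1 := ccontD b1 b2'; have s2 := ccontB s1 b3'; have s3 := ccontB s2 b4'.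
rewrite /nonlin meanB // meanB // meanB // meanD //.
by rewrite !meanZ // mUv mv mU mg; ring.
Qed.

Lemma eigenfunction_exists eps g phi : m * m = 'i%C * (K / nu)%:C -> complex.Re m != 0 ->
  (forall y, U^`(2)%classic y = U2 y) -> 0 < eps -> ccont g -> primitive2 g phi ->
  solves2 (m * m) (forcing eps g phi) g ->
  is_eigenvalue (Lop U nu eps (K * eps))
    ('i%C * K%:C - (nu * eps ^+ 2)%:C - 'i%C * ((eps ^+ 2)%:C * meanU phi)).
Proof.
move=> mm mr EU2 e0 cg Pg Sg.
have mn0 : m != 0 by apply: contraNneq mr => ->.
have [mg mN] := fixed_point_mean mn0 cg Pg Sg.
have [phi1 [pp d1 d2 mp _]] := Pg; have cp := cder_ccont d1.
have {}d2 : cder phi1 g by apply: eq_cder d2 => y; rewrite mg subr0.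
have [pg [g1 dg dg1]] := Sg.
pose g2 y := m * m * g y + forcing eps g phi y.
have cg2 : ccont g2 by apply: ccontD; [exact: ccontZ|exact: forcing_ccont].
(* The eigenfunction is the vorticity psi'' - eps^2 psi of the stream function psi = 1 + eps phi. *)
pose F y := - (eps ^+ 2)%:C + eps%:C * vort eps g phi y.
pose F2 y := eps%:C * (g2 y - (eps ^+ 2)%:C * g y).
have dF1 : cder F (fun y => eps%:C * (g1 y - (eps ^+ 2)%:C * phi1 y)).
  apply: eq_cder (cderD (cder_cst (- (eps ^+ 2)%:C)) (cderZ eps%:C
    (cderB dg (cderZ (eps ^+ 2)%:C d1)))) => y; exact: add0r.
have dF2 : cder (fun y => eps%:C * (g1 y - (eps ^+ 2)%:C * phi1 y)) F2.
  exact: cderZ (cderB dg1 (cderZ (eps ^+ 2)%:C d2)).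
have pF : periodic F (2 * pi) by move=> y; rewrite /F /vort pg pp.
have cF2 : ccont F2 by apply: ccontZ; apply: ccontB => //; exact: ccontZ.
have cF := cder_ccont dF1.
pose psi y := 1 + eps%:C * phi y.
have Spsi : solves2 (eps%:C * eps%:C) F psi.
  split; first by move=> y; rewrite /psi pp.
  exists (fun y => eps%:C * phi1 y).
    by apply: eq_cder (cderD (cder_cst 1) (cderZ eps%:C d1)) => y; exact: add0r.
  apply: eq_cder (cderZ eps%:C d2) => y.
  by rewrite /F /psi /vort expr2 rmorphM; ring.
(* The resolvent at eps^2 is an instance of the general case, with root m = eps. *)
have e0' : complex.Re (eps%:C : R[i]) != 0 by rewrite /= gt_eqF.
have [_ hres] := resolventT_solves2 e0' cF pF Spsi.
have hdyy := dyy_cder2 dF1 dF2 cF2 pF.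
have FF := ae_filter_ringOfSetsType (@lebesgue_measure R).
exists F; split.
- by exists F2; exact: cder2_is_dyy dF1 dF2 cF2 pF.
(* F is nontrivial because its mean is -eps^2. *)
- move=> F0; have : mean F = - (eps ^+ 2)%:C.
    have cv := vort_ccont eps cg cp.
    rewrite /F meanD; [|exact: ccont_cst|exact: ccontZ].
    rewrite mean_cst meanZ // /vort meanB // ?meanZ ?mg ?mp ?mulr0 ?subrr ?mulr0 ?addr0 //.
    exact: ccontZ.
  have -> : mean F = 0.
    rewrite -[RHS]mean0 /mean; congr (_ * _); apply: cintT_ae.
    + exact: ccont_cint.
    + exact/ccont_cint/ccont_cst.
    + by apply: filterS F0 => y; apply.
  move=> /esym/eqP; rewrite oppr_eq0 => /eqP/(congr1 (@complex.Re R))/= /eqP.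
  by rewrite expf_eq0 /= gt_eqF.
- apply: filterS2 hres hdyy => y hr hd _.
  have E2 : (eps ^+ 2)%:C = eps%:C * eps%:C :> R[i] by rewrite expr2 rmorphM.
  have nu0 : nu%:C != 0 :> R[i] by rewrite eq_complex /= negb_and gt_eqF.
  rewrite /Lop hd EU2 E2 hr /F2 /g2 mm /forcing mN /psi /F /nonlin /vort.
  rewrite !rmorphB !rmorphM !fmorphV.
  by field.
Qed.

End FixedPointEquation.

(** * The unperturbed problem and the sign of the second-order coefficient *)

Lemma cder0_mean0 (R : realType) (q : R -> R[i]) : cder q (fun=> 0) -> mean q = 0 ->
  forall y, q y = 0.
Proof.
move=> dq mq y; rewrite -mq -[LHS]mean_cst; congr mean.
by apply/funext => t; exact: cder0_cst dq _ _.
Qed.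

Lemma normT_ltP (R : realType) (f : R -> R[i]) (c : R) : 0 < c ->
  (c < normT f) = (c ^+ 2 < (2 * pi)^-1 *
     rintT (fun y => complex.Re (f y) ^+ 2 + complex.Im (f y) ^+ 2)).
Proof.
move=> c0; rewrite /normT.
have -> : complex.Re (innerT f f) = (2 * pi)^-1 *
     rintT (fun y => complex.Re (f y) ^+ 2 + complex.Im (f y) ^+ 2).
  rewrite /innerT ReImE /= mul0r subr0; congr (_ * rintT _).
  by apply/funext => y; case: (f y) => a b /=; ring.
set x := _ * _.
rewrite -[in LHS](sqr_sqrtr (ltW c0)) -(ltr_pXn2r (n := 2)) ?nnegrE ?sqr_ge0 ?sqrtr_ge0 //.
rewrite sqr_sqrtr; last exact: ltW.
(* For negative x the square root is 0 by convention, and both inequalities are false. *)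
have [x0|x0] := leP 0 x; first by rewrite sqr_sqrtr.
by rewrite (ltr0_sqrtr x0) expr0n /= !ltNge (ltW (exprn_gt0 2 c0)) (le_trans (ltW x0) (ltW (exprn_gt0 2 c0))).
Qed.

Lemma meanU_unperturbed (R : realType) (U U1 U2 : R -> R) (nu K : R) (m : R[i])
    (g0 phi0 : R -> R[i]) :
  periodic U (2 * pi) -> (forall y : R, is_derive y 1 U (U1 y)) ->
  (forall y : R, is_derive y 1 U1 (U2 y)) -> continuous U2 -> 0 < nu ->
  mean (fun y => (U y)%:C : R[i]) = 0 ->
  m * m = 'i%C * (K / nu)%:C -> complex.Re m != 0 ->
  solves2 (m * m) (fun y => (nu^-1)%:C * (- 'i%C * (U2 y)%:C)) g0 ->
  primitive2 g0 phi0 ->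
  nu < normT (resolventT ('i%C * (K / nu)%:C) (fun y => (U1 y)%:C)) ->
  nu < complex.Im (meanU U phi0).
Proof.
move=> pU dU dU1 cU2 nu0 mU mm mr Sg Pg hn.
have mn0 : m != 0 by apply: contraNneq mr => ->.
have nuC : nu%:C != 0 :> R[i] by rewrite eq_complex /= negb_and gt_eqF.
have dUc := cder_real dU; have dU1c := cder_real dU1.
have cU2c := ccont_real cU2; have cU1c := cder_ccont dU1c; have cUc := cder_ccont dUc.
have pUc : periodic (fun y => (U y)%:C : R[i]) (2 * pi) by move=> y; rewrite pU.
have pU1c := cder_periodic dUc pUc.
have mU1 := mean_cder_periodic dUc cU1c pUc.
have mU2 := mean_cder_periodic dU1c cU2c pU1c.
have mg : mean g0 = 0.
  apply: mean_eq0_of_solves2 Sg; [by rewrite mulf_neq0|by do 2 apply: ccontZ|].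
  by rewrite meanZ ?meanZ ?mU2 ?mulr0 //; exact: ccontZ.
have [pg [g1 dg dg1]] := Sg; have [p [pphi dphi dp _ mp]] := Pg.
have {}dp : cder p g0 by apply: eq_cder dp => y; rewrite mg subr0.
have cp := cder_ccont dp; have pp := cder_periodic dphi pphi.
have cg1 := cder_ccont dg1; have cg := cder_ccont dg; have cphi := cder_ccont dphi.
have mphi : mean phi0 = 0 by case: Pg => ? [].
have mg1 := mean_cder_periodic dg cg1 pg.
pose c : R[i] := (nu^-1)%:C * 'i%C.
(* The equation for g0 is integrated once here and once more in [E2]; no constants appear, as all
   terms have mean zero. *)
have E1 y : g1 y = m * m * p y - c * (U1 y)%:C.
  apply/eqP; rewrite -subr_eq0; apply/eqP.
  apply: (@cder0_mean0 R (fun y => g1 y - (m * m * p y - c * (U1 y)%:C))).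
    by apply: eq_cder (cderB dg1 (cderB (cderZ (m * m) dp) (cderZ c dU1c))) => t;
      rewrite /c; ring.
  have k1 := ccontZ (m * m) cp; have k2 := ccontZ c cU1c; have k3 := ccontB k1 k2.
  by rewrite meanB // meanB // !meanZ // mg1 mp mU1 !mulr0 !subr0.
have E2 y : g0 y = m * m * phi0 y - c * (U y)%:C.
  apply/eqP; rewrite -subr_eq0; apply/eqP.
  apply: (@cder0_mean0 R (fun y => g0 y - (m * m * phi0 y - c * (U y)%:C))).
    apply: eq_cder (cderB dg (cderB (cderZ (m * m) dphi) (cderZ c dUc))) => t.
    by rewrite E1 subrr.
  have k1 := ccontZ (m * m) cphi; have k2 := ccontZ c cUc; have k3 := ccontB k1 k2.
  by rewrite meanB // meanB // !meanZ // mg mphi mU !mulr0 !subr0.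
(* This identifies chi = i nu phi0', so the hypothesis on the norm of chi becomes one on phi0'. *)
have Schi : solves2 (m * m) (fun y => (U1 y)%:C) (fun y => 'i%C * nu%:C * p y).
  split; first by move=> y; rewrite pp.
  exists (fun y => 'i%C * nu%:C * g0 y); first exact: cderZ.
  apply: eq_cder (cderZ ('i%C * nu%:C) dg) => y.
  rewrite E1 /c fmorphV.
  have i2 : 'i%C * 'i%C = -1 :> R[i] by rewrite -expr2 sqr_i.
  rewrite mulrBr (_ : 'i%C * nu%:C * (nu%:C^-1 * 'i%C * (U1 y)%:C) = ('i%C * 'i%C) * (U1 y)%:C).
    by rewrite i2; ring.
  by field.
have [[_ Lr Li Lq] hres] := resolventT_solves2 mr cU1c pU1c Schi.
rewrite -mm normT_ltP // in hn.
pose P := rintT (fun y => complex.Re (p y) ^+ 2 + complex.Im (p y) ^+ 2).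
have [cpr cpi] := cp.
have csq : continuous (fun y => complex.Re (p y) ^+ 2 + complex.Im (p y) ^+ 2).
  exact: continuous_add (continuous_mul cpr cpr) (continuous_mul cpi cpi).
have isq := ccont_integrable 0 (2 * pi) csq.
have EN : rintT (fun y => complex.Re (resolventT (m * m) (fun y => (U1 y)%:C) y) ^+ 2
    + complex.Im (resolventT (m * m) (fun y => (U1 y)%:C) y) ^+ 2) = nu ^+ 2 * P.
  rewrite /P -rintT_scale //; apply: rintT_ae.
  - by apply: eq_integrable Lq => // y _ /=; rewrite normc_sqr.
  - exact: integrable_scale.
  - apply: filterS hres; first exact: (ae_filter_ringOfSetsType (@lebesgue_measure R)).
    by move=> y /= ->; rewrite !ReImE /=; ring.
have Im1 : complex.Im (meanU U phi0) = (2 * pi)^-1 * rintT (fun y => U y * complex.Im (phi0 y)).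
  rewrite /meanU /mean ReImE /= mul0r addr0; congr (_ * rintT _).
  by apply/funext => y; rewrite ReImE /= mul0r addr0.
(* W' = nu |phi0'|^2 - U Im(phi0), whose integral over a period vanishes. *)
pose W y := nu * (complex.Re (phi0 y) * complex.Re (p y) + complex.Im (phi0 y) * complex.Im (p y)).
pose W' y := nu * (complex.Re (p y) ^+ 2 + complex.Im (p y) ^+ 2)
    + -1 * (U y * complex.Im (phi0 y)).
have dW (y : R) : is_derive y 1 W (W' y).
  have [a b] := dphi y; have [a' b'] := dp y.
  refine (eq_is_derive _ (is_derive_mul (is_derive_cst nu y 1)
    (is_derive_add (is_derive_mul a a') (is_derive_mul b b')))).
  (* By [E2] the second derivative of phi0 contributes i K |phi0|^2, which is purely imaginary and
     drops out, and a term in U whose real part is - U Im(phi0). *)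
  rewrite mul0r add0r (E2 y) mm /c !ReImE /= /W'.
  by field; rewrite gt_eqF.
have cU := is_derive_continuous dU; have [_ cphii] := cphi.
have cUb := continuous_mul cU cphii.
have cnu : continuous (fun _ : R => nu) by move=> ?; exact: cvg_cst.
have cm1 : continuous (fun _ : R => -1 : R) by move=> ?; exact: cvg_cst.
have cW : continuous W' by exact: continuous_add (continuous_mul cnu csq) (continuous_mul cm1 cUb).
have := rintT_derive dW cW.
rewrite /W' rintT_add; [|exact/integrable_scale|exact/integrable_scale/ccont_integrable].
rewrite !rintT_scale //; last exact: ccont_integrable.
have -> : W (2 * pi) - W 0 = 0 by rewrite /W -[2 * pi]add0r pphi pp subrr.
rewrite -/P => EP; rewrite Im1.
have -> : rintT (fun y => U y * complex.Im (phi0 y)) = nu * P by lra.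
(* Both inequalities say that the mean of |phi0'|^2 exceeds 1: one is scaled by nu^2, the other by
   nu. *)
move: hn; rewrite EN mulrCA -[ltLHS]mulr1 ltr_pM2l ?exprn_gt0 //.
by rewrite mulrCA -[X in _ -> X < _]mulr1 ltr_pM2l.
Qed.

(** * The square root of i K / nu and the unstable eigenvalue *)

Lemma resolvent_root (R : realType) (k : R) : 0 < k ->
  exists m : R[i], m * m = 'i%C * k%:C /\ complex.Re m != 0.
Proof.
(* Since (1 + i)^2 = 2 i, the root is (1 + i) sqrt(k / 2). *)
move=> k0; pose a := Num.sqrt (k / 2); have a0 : 0 < a by rewrite sqrtr_gt0 divr_gt0.
exists (a +i* a); split; last by rewrite /= gt_eqF.
have aa : a * a = k / 2 by rewrite -expr2 sqr_sqrtr // ltW // divr_gt0.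
by apply: eq_complexP; rewrite !ReImE /= aa; lra.
Qed.

Unset Implicit Arguments.

Theorem mainTheorem2 (R : realType) (U : R -> R) (nu K : R)
  (hU : classCT 2 U) (hU0 : rintT U = 0)
  (hnu : 0 < nu) (hK : 0 < K) (hKnu : nu < K)
  (hnorm : nu < normT (resolventT ('i%C * (K / nu)%:C) (fun y => (U^`()%classic y)%:C))) :
  exists2 eps0 : R, 0 < eps0 &
    forall eps : R, 0 < eps -> eps < eps0 ->
      exists2 lambda : R[i], 0 < complex.Re lambda &
        is_eigenvalue (Lop U nu eps (K * eps)) lambda.
Proof.
have [pU derU cU2] := hU.
set U1 := U^`()%classic in hnorm; pose U2 := U^`(2)%classic.
have dU (y : R) : is_derive y 1 U (U1 y).
  by apply: DeriveDef; [exact: (derU 0)|rewrite -derive1E].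
have dU1 (y : R) : is_derive y 1 U1 (U2 y).
  by apply: DeriveDef; [exact: (derU 1)|rewrite -derive1E].
have mU : mean (fun y => (U y)%:C : R[i]) = 0.
  rewrite /mean /cintT /= hU0 (_ : rintT (fun=> 0) = 0) ?mulr0 //.
  have c0 : continuous (fun _ : R => 0 : R) by move=> y; exact: cvg_cst.
  by rewrite (rintT_derive (fun y => is_derive_cst (0 : R) y 1) c0) subrr.
have cU := is_derive_continuous dU.
have dUc := cder_real dU; have dU1c := cder_real dU1.
have pUc : periodic (fun y => (U y)%:C : R[i]) (2 * pi) by move=> y; rewrite pU.
have pU2c := cder_periodic dU1c (cder_periodic dUc pUc).
have [M1 M10 hM1] := periodic_bounded (ccont_real cU) pUc.
have [M2 M20 hM2] := periodic_bounded (ccont_real cU2) pU2c.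
pose M := M1 + M2.
have hMU y : bd M ((U y)%:C : R[i]) by apply: bdW (hM1 y); rewrite lerDl.
have hMU2 y : bd M ((U2 y)%:C : R[i]) by apply: bdW (hM2 y); rewrite lerDr.
have [m [mm mr]] := resolvent_root (divr_gt0 hK hnu).
have cf : ccont (fun y => (nu^-1)%:C * (- 'i%C * (U2 y)%:C) : R[i]).
  by do 2 apply: ccontZ; exact: ccont_real.
have [g0 Sg0] := periodic_ode2 mr cf
  (fun y => congr1 (fun z => (nu^-1)%:C * (- 'i%C * z)) (pU2c y)).
have cg0 := solves2_ccont Sg0.
have [phi0 P0] := primitive2_exists cg0 Sg0.1.
have hs0 := meanU_unperturbed pU dU dU1 cU2 hnu mU mm mr Sg0 P0 hnorm.
have [C C0 [e1 e10 he1]] := fixed_point_exists pU dU dU1 cU2 hnu hMU hMU2 mr Sg0.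
(* [A * eps] bounds the change of <U phi> when g0 is replaced by g; eps is then taken so small that
   this is at most half the gap between Im <U phi0> and nu. *)
pose A := 2 * (M * (cprim2 R * C)).
have A0 : 0 <= A.
  apply: mulr_ge0 => //; apply: mulr_ge0; first exact: addr_ge0.
  by apply: mulr_ge0 => //; exact: cprim2_ge0.
have [|e2 e20 he2] := @eps_small R A ((complex.Im (meanU U phi0) - nu) / 2) A0.
  by rewrite divr_gt0 // subr_gt0.
exists (Num.min e1 e2); first by rewrite lt_min e10.
move=> eps eps0; rewrite lt_min => /andP[l1 l2].
have [g [phi [cg Pg Sg hg]]] := he1 eps eps0 l1.
have {}he2 := he2 eps eps0 l2.
exists ('i%C * K%:C - (nu * eps ^+ 2)%:C - 'i%C * ((eps ^+ 2)%:C * meanU U phi)); last first.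
  have eig := eigenfunction_exists pU dU dU1 cU2 hnu.
  exact: (eig K m mU eps g phi mm mr (fun y => erefl) eps0 cg Pg Sg).
have cD := ccontB cg cg0; have PD := primitive2B cg cg0 Pg P0.
have cphi := primitive2_ccont Pg; have cphi0 := primitive2_ccont P0.
have [_ hb] := meanU_bd dU hMU (ccontB cphi cphi0) (primitive2_bound cD PD hg).
rewrite (meanUB dU cphi cphi0) ImD ImN in hb; have := ler_norm (- (complex.Im (meanU U phi) - complex.Im (meanU U phi0))).
rewrite normrN => h2.
have E2 : 0 < eps ^+ 2 by rewrite exprn_gt0.
have hs : nu < complex.Im (meanU U phi) by move: he2; rewrite /A; lra.
(* Exactly, Re lambda = eps^2 (Im <U phi> - nu). *)
have := mulr_gt0 E2 (ltac:(rewrite subr_gt0; exact: hs) : 0 < complex.Im (meanU U phi) - nu).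
by case: (meanU U phi) => a b /=; lra.
Qed.
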